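(* Let $d\geq2$ and let $\{F_n\}_{n\geq1}$ be a sequence of Hénon maps $F_n(z,w)=(z^d+q_n(z)+\delta_n w,\ z)$, where each $q_n$ is a polynomial of degree at most $d-1$, each $\delta_n\neq0$, and the moduli of all coefficients of the $q_n$ and the $|\delta_n|$ are bounded above by a constant independent of $n$. Then for every $r>0$ the sublevel set \[ \Omega_{\{F_n\},r}=\{(z,w)\in\mathbb{C}^2: G^+_{\{F_n\}}(z,w)<r\} \] is a Short $\mathbb{C}^2$.
   Context: The random Green's function is $G^+_{\{F_n\}}(z,w)=\lim_{n\to\infty}\frac{1}{d^n}\log^+\|F_n\circ\cdots\circ F_1(z,w)\|$ for $(z,w)\in\mathbb{C}^2$, where $\log^+x=\max\{\log x,0\}$; under the stated hypotheses this limit exists at every point. Definition (Short $\mathbb{C}^k$): for $k\geq 2$, a domain $\Omega\subseteq\mathbb{C}^k$ is a Short $\mathbb{C}^k$ if it is the union of an increasing sequence of domains each biholomorphic to the unit ball of $\mathbb{C}^k$, its Kobayashi–Royden infinitesimal pseudometric vanishes identically, and it carries a non-constant plurisubharmonic function bounded above. *)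

(* Defs.v *)
From Stdlib Require Import Reals.
From Coquelicot Require Import Coquelicot.
Open Scope R_scope.

Definition C2 : NormedModule C_AbsRing :=
  prod_NormedModule C_AbsRing C_NormedModule C_NormedModule.

Definition norm2 (p : C2) : R :=
  sqrt (Cmod (fst p) ^ 2 + Cmod (snd p) ^ 2).

Definition logp (x : R) : R := Rmax (ln x) 0.

Definition henon (d : nat) (a : nat -> C) (delta : C) (p : C2) : C2 :=
  let z := fst p in let w := snd p in
  ((pow_n (K:=C_Ring) z d + sum_n (G:=C_AbelianMonoid)
        (fun k => (a k * pow_n (K:=C_Ring) z k)%C) (d - 1)
    + delta * w)%C, z).

Fixpoint henon_comp (d : nat) (a : nat -> nat -> C) (delta : nat -> C)
    (n : nat) (p : C2) : C2 :=
  match n with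
  | O => p
  | S m => henon d (a (S m)) (delta (S m)) (henon_comp d a delta m p)
  end.

Definition green (d : nat) (a : nat -> nat -> C) (delta : nat -> C) (p : C2) : Rbar :=
  Lim_seq (fun n => logp (norm2 (henon_comp d a delta n p)) / INR d ^ n).

Definition domain (D : C2 -> Prop) : Prop :=
  open D /\ (exists p, D p) /\
  forall A B : C2 -> Prop, open A -> open B ->
    (forall p, D p -> A p \/ B p) ->
    (forall p, D p -> A p -> B p -> False) ->
    (exists p, D p /\ A p) -> (exists p, D p /\ B p) -> False.

Definition unit_ball : C2 -> Prop := fun p => norm2 p < 1.

Definition holomorphic_on (U : C2 -> Prop) (F : C2 -> C2) : Prop :=
  forall p, U p -> ex_filterdiff (K:=C_AbsRing) (U:=C2) (V:=C2) F (locally p).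

Definition biholomorphic (U V : C2 -> Prop) : Prop :=
  exists (f g : C2 -> C2),
    holomorphic_on U f /\ holomorphic_on V g /\
    (forall p, U p -> V (f p)) /\ (forall p, V p -> U (g p)) /\
    (forall p, U p -> g (f p) = p) /\ (forall p, V p -> f (g p) = p).

Definition holo_disc (Omega : C2 -> Prop) (f : C -> C2) : Prop :=
  forall z : C, Cmod z < 1 ->
    ex_derive (K:=C_AbsRing) (V:=C2) f z /\ Omega (f z).

Definition kobayashi_royden (Omega : C2 -> Prop) (p v : C2) : Rbar :=
  Glb_Rbar (fun alpha => 0 < alpha /\
    exists f : C -> C2, holo_disc Omega f /\ f (RtoC 0) = p /\
      is_derive (K:=C_AbsRing) (V:=C2) f (RtoC 0) (scal (RtoC (/ alpha)) v)).

Definition openC (U : C -> Prop) : Prop := forall z, U z -> locally z U.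
Definition interiorC (K : C -> Prop) (z : C) : Prop := locally z K.
Definition compactC (K : C -> Prop) : Prop :=
  (forall z, ~ K z -> locally z (fun y => ~ K y)) /\
  exists M, forall z, K z -> Cmod z <= M.

Definition usc_at {T : UniformSpace} (U : T -> Prop) (u : T -> Rbar) (z : T) : Prop :=
  forall M : R, Rbar_lt (u z) M ->
    locally z (fun y => U y -> Rbar_lt (u y) M).

Definition dx (h : C -> R) : C -> R := fun p => Derive (fun t => h (t, snd p)) (fst p).
Definition dy (h : C -> R) : C -> R := fun p => Derive (fun t => h (fst p, t)) (snd p).

Definition has_partials (h : C -> R) (p : C) : Prop :=
  ex_derive (fun t => h (t, snd p)) (fst p) /\ ex_derive (fun t => h (fst p, t)) (snd p).

Definition harmonic_at (h : C -> R) (z : C) : Prop :=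
  locally z (fun p =>
    has_partials h p /\ has_partials (dx h) p /\ has_partials (dy h) p /\
    continuous h p /\ continuous (dx h) p /\ continuous (dy h) p /\
    continuous (dx (dx h)) p /\ continuous (dy (dx h)) p /\
    continuous (dx (dy h)) p /\ continuous (dy (dy h)) p /\
    dx (dx h) p + dy (dy h) p = 0).

(** Hörmander, Def. 1.6.1: u : U -> [-oo,+oo) is subharmonic in the open set U
    if it is upper semicontinuous and for every compact K in U and every
    continuous h on K, harmonic in the interior of K, with u <= h on the
    boundary of K, one has u <= h on K. *)
Definition subharmonic_on (U : C -> Prop) (u : C -> Rbar) : Prop :=
  (forall z, U z -> u z <> p_infty) /\
  (forall z, U z -> usc_at U u z) /\
  forall (K : C -> Prop) (h : C -> R),
    compactC K -> (forall z, K z -> U z) ->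
    (forall z, K z -> filterlim h (within K (locally z)) (locally (h z))) ->
    (forall z, interiorC K z -> harmonic_at h z) ->
    (forall z, K z -> ~ interiorC K z -> Rbar_le (u z) (h z)) ->
    forall z, K z -> Rbar_le (u z) (h z).

(** Hörmander, Def. 2.6.1: u : Omega -> [-oo,+oo) is plurisubharmonic if it is
    upper semicontinuous and for all a, b in C^2 the function
    tau |-> u(a + tau b) is subharmonic where defined. *)
Definition plurisubharmonic_on (Omega : C2 -> Prop) (u : C2 -> Rbar) : Prop :=
  (forall p, Omega p -> u p <> p_infty) /\
  (forall p, Omega p -> usc_at Omega u p) /\
  forall a b : C2,
    subharmonic_on (fun tau => Omega (plus a (scal tau b)))
                   (fun tau => u (plus a (scal tau b))).

Definition short_C2 (Omega : C2 -> Prop) : Prop :=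
  (exists Om : nat -> C2 -> Prop,
      (forall j, domain (Om j)) /\
      (forall j p, Om j p -> Om (S j) p) /\
      (forall p, Omega p <-> exists j, Om j p) /\
      (forall j, biholomorphic (Om j) unit_ball)) /\
  (forall p v : C2, Omega p -> kobayashi_royden Omega p v = Finite 0) /\
  (exists u : C2 -> Rbar,
      plurisubharmonic_on Omega u /\
      (exists M : R, forall p, Omega p -> Rbar_le (u p) M) /\
      (exists p q, Omega p /\ Omega q /\ u p <> u q)).

(* Main.v *)
(** Let F(n) be the composition of the first n maps and A a constant with
    max(1,|F_k p|) <= A max(1,|p|)^d for all k.  The functions
    g_n = (log+ |F(n)| + log A) / d^n decrease to G, so that {G < r} is the increasing union of
    the sets {g_n < r}, which are preimages of balls under the automorphisms F(n) of C^2.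

    Since G is a decreasing limit of the continuous functions g_n, its plurisubharmonicity
    reduces, by compactness of the boundary, to the maximum principle for g_n - h, which is
    tested on the four points t+s, t-s, t+is, t-is.

    The Kobayashi-Royden metric vanishes at p because the disc
    z -> F(n)^-1 (F(n) p + z DF(n)_p v / alpha) stays in {G < r} for large n:
    if g_N(p) < r' < r then |F(n) p| and |DF(n)_p v| are O(exp(r' d^n)), whereas the radius of
    the n-th ball is exp(r d^n) / A.

    Finally G >= d^-N log(t/2) at F(N)^-1 (t,0) for large t, while G <= d^-N log A at
    F(N)^-1 (0,0), so G is not constant on {G < r}. *)

Require Import Defs.
From Stdlib Require Import Reals Lra Lia Psatz Classical ClassicalEpsilon IndefiniteDescription List.
From Coquelicot Require Import Coquelicot.
Open Scope R_scope.

(** * Bounded functions and second-order jets *)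

(** No integral means are used: subharmonicity is extracted from a discrete Laplacian, [four]. Its
    value on log+ of the norm is at least -O(s^3), its value on a harmonic function is o(s^2), and
    eta |z|^2 contributes exactly 4 eta s^2. Second-order expansions with a cubic remainder are
    therefore enough; polynomials have them, and the same expansions give complex differentiability.
    For the metric, the obstacle is that the differentials might outgrow the balls. The differential
    of the (k+1)-st map at F(k) p is of order |F(k) p|^(d-1). On an orbit with |F(k) p| <= exp(r'
    d^k) these exponents add up to r' times the sum of (d-1) d^k over N <= k < n, which is less than
    r' d^n, so DF(n) costs no more than the orbit itself. The constants picked up at each step are
    absorbed because A is taken large enough for the maps and for their differentials. *)

Definition bdd (rho : C -> C) : Prop :=
  exists B, forall s, Cmod s <= 1 -> Cmod (rho s) <= B.

Lemma bdd_const (c : C) : bdd (fun _ => c).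
Proof. exists (Cmod c). intros; lra. Qed.

Lemma bdd_id : bdd (fun s => s).
Proof. exists 1. auto. Qed.

Lemma bdd_plus (f g : C -> C) : bdd f -> bdd g -> bdd (fun s => f s + g s)%C.
Proof.
  intros [A HA] [B HB]. exists (A + B). intros s Hs.
  specialize (HA s Hs); specialize (HB s Hs).
  generalize (Cmod_triangle (f s) (g s)); lra.
Qed.

Lemma bdd_mult (f g : C -> C) : bdd f -> bdd g -> bdd (fun s => f s * g s)%C.
Proof.
  intros [A HA] [B HB]. exists (A * B). intros s Hs.
  rewrite Cmod_mult.
  apply Rmult_le_compat; auto using Cmod_ge_0.
Qed.

Lemma bdd_rot (f : C -> C) (c : C) : Cmod c = 1 -> bdd f -> bdd (fun s => f (c * s)%C).
Proof.
  intros Hc [B HB]. exists B. intros s Hs. apply HB.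
  rewrite Cmod_mult, Hc. lra.
Qed.

Ltac bdd_tac := repeat first
  [ assumption | apply bdd_const | apply bdd_id
  | apply bdd_plus | apply bdd_mult ].

(* [c] plays the role of f'(z); the expansion is asked for all [s], which is
   enough for the polynomials considered here. *)
Definition jet (f : C -> C) (z c : C) : Prop :=
  exists (c2 : C) (rho : C -> C), bdd rho /\
    forall s, f (z + s)%C = (f z + c * s + c2 * (s * s) + rho s * (s * s * s))%C.

Lemma jet_ext (f g : C -> C) z c c' :
  (forall x, f x = g x) -> c = c' -> jet f z c -> jet g z c'.
Proof.
  intros E <- (c2 & rho & Hb & H). exists c2, rho. split; [exact Hb|].
  intros s. rewrite <- !E. apply H.
Qed.

Lemma jet_const (k z : C) : jet (fun _ => k) z 0%C.
Proof. exists 0%C, (fun _ => 0%C). split; [apply bdd_const|]. intros; ring. Qed.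

Lemma jet_id (z : C) : jet (fun x => x) z 1%C.
Proof. exists 0%C, (fun _ => 0%C). split; [apply bdd_const|]. intros; ring. Qed.

Lemma jet_plus (f g : C -> C) z a b :
  jet f z a -> jet g z b -> jet (fun x => f x + g x)%C z (a + b)%C.
Proof.
  intros (a2 & r & Hr & Hf) (b2 & q & Hq & Hg).
  exists (a2 + b2)%C, (fun s => r s + q s)%C. split; [bdd_tac|].
  intros s. rewrite Hf, Hg. ring.
Qed.

Lemma jet_mult (f g : C -> C) z a b :
  jet f z a -> jet g z b -> jet (fun x => f x * g x)%C z (a * g z + f z * b)%C.
Proof.
  intros (a2 & r & Hr & Hf) (b2 & q & Hq & Hg).
  exists (f z * b2 + a * b + a2 * g z)%C,
    (fun s => (a * b2 + a2 * b) + a2 * b2 * s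
       + r s * (g z + b * s + b2 * (s * s) + q s * (s * s * s))
       + (f z + a * s + a2 * (s * s)) * q s)%C.
  split; [bdd_tac|].
  intros s. rewrite Hf, Hg. ring.
Qed.

Lemma jet_scal (f : C -> C) z a k : jet f z a -> jet (fun x => k * f x)%C z (k * a)%C.
Proof.
  intros H. apply jet_ext with (3 := jet_mult (fun _ => k) f z _ _ (jet_const k z) H).
  - reflexivity.
  - ring.
Qed.

Lemma jet_pow (f : C -> C) z a n : jet f z a ->
  jet (fun x => pow_n (K:=C_Ring) (f x) n) z
      (INR n * pow_n (K:=C_Ring) (f z) (pred n) * a)%C.
Proof.
  intros H. induction n as [|n IH].
  - apply jet_ext with (3 := jet_const 1%C z).
    + reflexivity.
    + simpl. ring.
  - apply jet_ext with (3 := jet_mult _ _ z _ _ H IH).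
    + reflexivity.
    (* The case n = 0 is separate because [pred 0 = 0]; the factor [INR 0] makes that value
       harmless. *)
    + rewrite S_INR, RtoC_plus. simpl pred.
      destruct n as [|n].
      * simpl. change (@one C_Ring) with (RtoC 1). ring.
      * simpl pred. change (pow_n (f z) (S n)) with (f z * pow_n (K:=C_Ring) (f z) n)%C. ring.
Qed.

Lemma jet_sum (f : nat -> C -> C) z a n : (forall k, (k <= n)%nat -> jet (f k) z (a k)) ->
  jet (fun x => sum_n (G:=C_AbelianMonoid) (fun k => f k x) n) z (sum_n (G:=C_AbelianMonoid) a n).
Proof.
  induction n as [|n IH]; intros H.
  - apply jet_ext with (3 := H 0%nat (le_n _)); intros; rewrite !sum_O; reflexivity.
  - apply jet_ext with (3 := jet_plus _ _ z _ _ (IH (fun k Hk => H k (le_S _ _ Hk))) (H (S n) (le_n _)));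
      intros; rewrite !sum_Sn; reflexivity.
Qed.

(** * Four-point means of log+ *)

Lemma ln_one_minus (x : R) : 0 <= x <= 1/2 -> - (2 * x) <= ln (1 - x).
Proof.
  intros Hx.
  assert (H : ln (/ (1 - x)) <= / (1 - x) - 1).
  { assert (0 < / (1 - x)) by (apply Rinv_0_lt_compat; lra).
    generalize (exp_ineq1_le (ln (/ (1-x)))). rewrite exp_ln by assumption. lra. }
  rewrite ln_Rinv in H by lra.
  assert (/ (1 - x) <= 1 + 2 * x).
  { apply Rmult_le_reg_l with (1 - x); [lra|]. rewrite Rinv_r by lra. nra. }
  lra.
Qed.

(** The five-point discrete Laplacian at t with step s, not divided by s^2. *)
Definition four (g : C -> R) (t : C) (s : R) : R :=
  g (t + s)%C + g (t + - (1) * s)%C + g (t + Ci * s)%C + g (t + - Ci * s)%C - 4 * g t.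

(** A discrete substitute for a nonnegative Laplacian, meaningful for functions that are only
    continuous: the defect may be negative, but only to third order in s. *)
Definition sub4 (g : C -> R) (t : C) : Prop :=
  exists B, exists delta, 0 < delta /\ forall s, 0 < s < delta -> - (B * s ^ 3) <= four g t s.

(* The terms of order 1 and 2 of the product of the values of f at t+s, t-s, t+is, t-is
   cancel because this product is invariant under s -> is. *)
Lemma jet_four_product (f : C -> C) (t c : C) : jet f t c ->
  exists E, bdd E /\ forall s : C,
    (f (t + s) * f (t + - (1) * s) * (f (t + Ci * s) * f (t + - Ci * s)))%C
    = (f t * f t * (f t * f t) + E s * (s * s * s))%C.
Proof.
  intros (c2 & rho & Hb & H).
  set (r1 := rho).
  set (r2 := fun s : C => rho (- (1) * s)%C).
  set (r3 := fun s : C => rho (Ci * s)%C).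
  set (r4 := fun s : C => rho (- Ci * s)%C).
  assert (B1 : bdd r1) by exact Hb.
  assert (B2 : bdd r2) by (apply bdd_rot; [apply Cmod_m1|exact Hb]).
  assert (B3 : bdd r3) by (apply bdd_rot; [apply Cmod_Ci|exact Hb]).
  assert (B4 : bdd r4).
  { apply bdd_rot; [|exact Hb]. rewrite Cmod_opp. apply Cmod_Ci. }
  (* The coefficient of s^2 in f(t+s) f(t-s). The pair t+is, t-is has -k instead, so the terms of
     order two cancel in the product of the pairs. *)
  pose (k := ((1 + 1) * f t * c2 + - (1) * (c * c))%C).
  pose (e1 := fun s : C => (c2 * c2 * s + r1 s * (f t + - (1) * c * s + c2 * (s * s))
     + - (1) * r2 s * (f t + c * s + c2 * (s * s)) + - (1) * r1 s * r2 s * (s * s * s))%C).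
  pose (e2 := fun s : C => (c2 * c2 * s + Ci * r4 s * (f t + Ci * c * s + - (1) * c2 * (s * s))
     + - Ci * r3 s * (f t + - Ci * c * s + - (1) * c2 * (s * s)) + r3 s * r4 s * (s * s * s))%C).
  assert (E1 : forall s, (f (t + s) * f (t + - (1) * s) = f t * f t + k * (s * s) + e1 s * (s * s * s))%C).
  { intros s. rewrite !H. change (rho s) with (r1 s). change (rho (- (1) * s)%C) with (r2 s).
    unfold e1, k. ring. }
  assert (I2 : (Ci * Ci = - (1))%C).
  { unfold Ci, Cmult, Copp, RtoC; simpl; f_equal; ring. }
  assert (E2 : forall s, (f (t + Ci * s) * f (t + - Ci * s) = f t * f t + - (1) * k * (s * s) + e2 s * (s * s * s))%C).
  { intros s. rewrite !H. change (rho (Ci * s)%C) with (r3 s). change (rho (- Ci * s)%C) with (r4 s).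
    replace (Ci * s * (Ci * s))%C with (- (1) * (s * s))%C by (rewrite <- I2; ring).
    replace (- Ci * s * (- Ci * s))%C with (- (1) * (s * s))%C by (rewrite <- I2; ring).
    unfold e2, k.
    (* [ring] does not know that i^2 = -1. The first form isolates the products [Ci * Ci]; the
       second evaluates them, except the one that also occurs in [e2]. *)
    transitivity (f t * f t + - (1) * ((1 + 1) * f t * c2) * (s * s) + c2 * c2 * s * (s * s * s)
       - (Ci * Ci) * (c * c) * (s * s)
       + Ci * (s * s * s) * (r4 s * (f t - c2 * (s * s)) - r3 s * (f t - c2 * (s * s)))
       + (Ci * Ci) * c * s * (s * s * s) * (r4 s + r3 s)
       - (Ci * Ci) * (r3 s * r4 s) * (s * s * s) * (s * s * s))%C; [ring|].
    transitivity (f t * f t + - (1) * ((1 + 1) * f t * c2) * (s * s) + c2 * c2 * s * (s * s * s)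
       + (c * c) * (s * s)
       + Ci * (s * s * s) * (r4 s * (f t - c2 * (s * s)) - r3 s * (f t - c2 * (s * s)))
       + (Ci * Ci) * c * s * (s * s * s) * (r4 s + r3 s)
       + (r3 s * r4 s) * (s * s * s) * (s * s * s))%C; [rewrite I2; ring|ring]. }
  exists (fun s => (- (1) * k * k * s + e1 s * (f t * f t + - (1) * k * (s * s) + e2 s * (s * s * s))
             + e2 s * (f t * f t + k * (s * s)))%C).
  split.
  - unfold e1, e2. bdd_tac.
  - intros s. rewrite E1, E2. ring.
Qed.

Lemma ln_le_logp (x : R) : ln x <= logp x.
Proof. apply Rmax_l. Qed.

Lemma logp_ge_0 (x : R) : 0 <= logp x.
Proof. apply Rmax_r. Qed.

(** Holds for every real x because [ln] has the default value 0 on x <= 0, which is also the value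
    of log+ there. *)
Lemma logp_ln (x : R) : logp x = ln (Rmax 1 x).
Proof.
  unfold logp. unfold Rmax at 2. destruct (Rle_dec 1 x) as [H|H].
  - apply Rmax_left. rewrite <- ln_1. apply ln_le; lra.
  - rewrite ln_1. apply Rmax_right.
    destruct (Rle_lt_dec x 0) as [H0|H0].
    + unfold ln. destruct (Rlt_dec 0 x); [exfalso; lra|apply Rle_refl].
    + rewrite <- ln_1. apply ln_le; lra.
Qed.

Lemma logp_le (x y : R) : x <= y -> logp x <= logp y.
Proof.
  intros H. rewrite !logp_ln. apply ln_le.
  - generalize (Rmax_l 1 x); lra.
  - apply Rle_max_compat_l; exact H.
Qed.

(* Where |f t| > 1, the function |f| is touched from below at t by the modulus of a
   holomorphic function, a linear combination of the two coordinates of f. *)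
Lemma sub4_logp_norm2 (f : C -> C2) (t a b : C) :
  jet (fun x => fst (f x)) t a -> jet (fun x => snd (f x)) t b ->
  sub4 (fun x => logp (norm2 (f x))) t.
Proof.
  intros Ha Hb.
  destruct (Rle_lt_dec (norm2 (f t)) 1) as [H1|H1].
  - exists 0, 1. split; [lra|]. intros s _. unfold four.
    assert (E : logp (norm2 (f t)) = 0).
    { rewrite logp_ln, Rmax_left by exact H1. apply ln_1. }
    rewrite E.
    generalize (logp_ge_0 (norm2 (f (t + s)%C))), (logp_ge_0 (norm2 (f (t + - (1) * s)%C))),
     (logp_ge_0 (norm2 (f (t + Ci * s)%C))), (logp_ge_0 (norm2 (f (t + - Ci * s)%C))). lra.
  - set (la := norm2 (f t)) in *.
    (* The unit covector dual to f(t) / |f(t)|: the combination l equals |f(t)| at t, and |l| <= |f|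
       everywhere by Cauchy-Schwarz. *)
    set (u := (Cconj (fst (f t)) / la)%C). set (v := (Cconj (snd (f t)) / la)%C).
    set (l := fun x => (u * fst (f x) + v * snd (f x))%C).
    assert (la0 : RtoC la <> RtoC 0).
    { intros E. apply RtoC_inj in E. lra. }
    assert (La : Cmod la = la) by (rewrite Cmod_R; apply Rabs_pos_eq; lra).
    assert (Hla2 : la ^ 2 = Cmod (fst (f t)) ^ 2 + Cmod (snd (f t)) ^ 2).
    { unfold la, norm2. rewrite pow2_sqrt; [reflexivity|]. apply Rplus_le_le_0_compat; apply pow2_ge_0. }
    assert (Huv : Cmod u ^ 2 + Cmod v ^ 2 = 1).
    { unfold u, v. rewrite !Cmod_div, !Cmod_conj, La by exact la0.
      unfold Rdiv. rewrite !Rpow_mult_distr.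
      replace 1 with (la ^ 2 * (/ la) ^ 2) by (field; lra).
      rewrite Hla2 at 1. ring. }
    assert (Hl : forall x, Cmod (l x) <= norm2 (f x)).
    { intros x. unfold l, norm2. eapply Rle_trans; [apply Cmod_triangle|].
      rewrite !Cmod_mult.
      generalize (Cmod_ge_0 (fst (f x))), (Cmod_ge_0 (snd (f x))).
      generalize (Cmod (fst (f x))) (Cmod (snd (f x))). intros p q Hp Hq.
      revert Huv. generalize (Cmod_ge_0 u), (Cmod_ge_0 v).
      generalize (Cmod u) (Cmod v). intros m n Hm Hn Huv.
      rewrite <- (sqrt_pow2 (m * p + n * q)) by nra.
      apply sqrt_le_1_alt.
      assert (0 <= (m * q - n * p) ^ 2) by apply pow2_ge_0.
      replace (p ^ 2 + q ^ 2) with ((m^2+n^2) * (p ^ 2 + q ^ 2)) by (rewrite Huv; ring).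
      nra. }
    assert (Hlt : l t = RtoC la).
    { unfold l, u, v.
      transitivity ((fst (f t) * Cconj (fst (f t)) + snd (f t) * Cconj (snd (f t))) / la)%C;
        [unfold Cdiv; ring|].
      rewrite <- !Cmod2_conj, <- RtoC_plus, <- Hla2, RtoC_pow. simpl. field. exact la0. }
    destruct (jet_four_product l t _ (jet_plus _ _ _ _ _ (jet_scal _ _ _ u Ha) (jet_scal _ _ _ v Hb)))
      as (E & [B HB] & HE).
    assert (B0 : 0 <= B).
    { eapply Rle_trans; [apply Cmod_ge_0|apply (HB 0%C)]. rewrite Cmod_0. lra. }
    (* The radius ensures B s^3 <= 1/2, the range of [ln_one_minus], and the factor 2 is the one in
       that estimate. *)
    exists (2 * B), (Rmin 1 (/ (2 * (B + 1)))).
    assert (Hd : 0 < / (2 * (B + 1))) by (apply Rinv_0_lt_compat; lra).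
    split; [apply Rmin_pos; lra|].
    intros s [Hs0 Hs].
    assert (Hs1 : s < 1) by (eapply Rlt_le_trans; [exact Hs|apply Rmin_l]).
    assert (Hs2 : s < / (2 * (B + 1))) by (eapply Rlt_le_trans; [exact Hs|apply Rmin_r]).
    assert (Hs3 : B * s ^ 3 <= 1 / 2).
    { assert (s * (2 * (B + 1)) <= 1).
      { apply Rmult_le_reg_r with (/ (2 * (B + 1))); [lra|].
        rewrite Rmult_assoc, Rinv_r by lra. lra. }
      assert (s ^ 2 <= 1) by nra. assert (0 <= B * s) by nra. simpl in *. nra. }
    specialize (HE s). apply (f_equal Cmod) in HE.
    rewrite !Cmod_mult in HE.
    assert (Hlow : la ^ 4 - B * s ^ 3 <= Cmod (l t * l t * (l t * l t) + E s * (s * s * s))).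
    { assert (HX : Cmod (l t * l t * (l t * l t)) = la ^ 4).
      { rewrite Hlt, !Cmod_mult, La. ring. }
      assert (HY : Cmod (E s * (s * s * s)) <= B * s ^ 3).
      { rewrite !Cmod_mult, Cmod_R, (Rabs_pos_eq s) by lra.
        replace (s * s * s) with (s ^ 3) by ring.
        apply Rmult_le_compat_r; [apply pow_le; lra|]. apply HB.
        rewrite Cmod_R, Rabs_pos_eq; lra. }
      generalize (Cmod_triangle (l t * l t * (l t * l t) + E s * (s * s * s)) (- (E s * (s * s * s)))).
      rewrite Cmod_opp.
      replace (l t * l t * (l t * l t) + E s * (s * s * s) + - (E s * (s * s * s)))%C
        with (l t * l t * (l t * l t))%C by ring.
      rewrite HX. lra. }
    rewrite <- HE in Hlow.
    assert (Hl4 : 1 <= la ^ 4) by (apply pow_R1_Rle; lra).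
    unfold four.
    set (p1 := (t + s)%C) in *. set (p2 := (t + - (1) * s)%C) in *.
    set (p3 := (t + Ci * s)%C) in *. set (p4 := (t + - Ci * s)%C) in *.
    fold la.
    assert (Pos : forall x, 0 <= Cmod (l x)) by (intros; apply Cmod_ge_0).
    assert (Q : 0 < Cmod (l p1) * Cmod (l p2) * (Cmod (l p3) * Cmod (l p4))) by lra.
    generalize (Pos p1), (Pos p2), (Pos p3), (Pos p4). intros P1 P2 P3 P4.
    assert (N : 0 < Cmod (l p1) /\ 0 < Cmod (l p2) /\ 0 < Cmod (l p3) /\ 0 < Cmod (l p4)).
    { repeat split; apply Rnot_le_lt; intros Z;
      match type of Z with ?X <= 0 => assert (X = 0) as W by lra; rewrite W in Q end; lra. }
    destruct N as (N1 & N2 & N3 & N4).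
    assert (LL : forall x, 0 < Cmod (l x) -> ln (Cmod (l x)) <= logp (norm2 (f x))).
    { intros x Hx. eapply Rle_trans; [|apply ln_le_logp]. apply ln_le; auto. }
    generalize (LL p1 N1), (LL p2 N2), (LL p3 N3), (LL p4 N4). intros M1 M2 M3 M4.
    (* Since la > 1, the absolute error B s^3 is also a relative one: la^4 - B s^3 >= la^4 (1 - B
       s^3). *)
    assert (LP : ln (la ^ 4 * (1 - B * s ^ 3)) <=
                 ln (Cmod (l p1) * Cmod (l p2) * (Cmod (l p3) * Cmod (l p4)))).
    { apply ln_le; [nra|]. eapply Rle_trans; [|exact Hlow].
      assert (0 <= B * s ^ 3) by (apply Rmult_le_pos; [lra|apply pow_le; lra]). nra. }
    rewrite ln_mult in LP by nra.
    rewrite !ln_mult in LP by (try apply Rmult_lt_0_compat; assumption).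
    assert (L1 : ln (la ^ 4) = 4 * logp la).
    { rewrite ln_pow by lra. rewrite logp_ln, Rmax_right by lra. simpl. ring. }
    assert (L2 := ln_one_minus (B * s ^ 3)).
    assert (0 <= B * s ^ 3) by (apply Rmult_le_pos; [lra|apply pow_le; lra]).
    lra.
Qed.

(** * Compact sets of the plane *)

(** Heine-Borel for increasing families: the largest index of a finite subcover serves for all of K.
    It yields the extreme value theorem as well as the Dini argument on the boundary. *)
Lemma compactC_eventually (K : C -> Prop) (P : nat -> C -> Prop) :
  compactC K -> (forall n z, P n z -> P (S n) z) ->
  (forall z, K z -> exists n, locally z (fun y : C => K y -> P n y)) ->
  exists n, forall z, K z -> P n z.
Proof.
  intros [Hcl [M HM]] Hmon Hloc.
  assert (Hmon' : forall n m z, (n <= m)%nat -> P n z -> P m z).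
  { intros n m z Hnm. induction Hnm; auto. }
  (* Points off K get a radius too, that of a ball missing K, so that there is a gauge on the whole
     square [-M,M]^2. *)
  assert (Hall : forall z : C, exists d : posreal, exists n,
             forall y : C, ball z d y -> K y -> P n y).
  { intros z. destruct (classic (K z)) as [Hz|Hz].
    - destruct (Hloc z Hz) as [n [d Hd]]. exists d, n. exact Hd.
    - destruct (Hcl z Hz) as [d Hd]. exists d, 0%nat. intros y Hy HK. destruct (Hd y Hy HK). }
  destruct (functional_choice _ Hall) as [delta Hdelta].
  (* [compactness_list] provides the finite cover only under a double negation, hence the proof by
     contradiction. *)
  apply NNPP. intros Hn.
  apply (compactness_list 2 (- M, (- M, tt)) (M, (M, tt)) (fun t => delta (fst t, fst (snd t)))).
  intros [l Hl]. apply Hn.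
  assert (HN : exists N, forall t, In t l -> forall y : C,
             ball (fst t, fst (snd t)) (delta (fst t, fst (snd t))) y -> K y -> P N y).
  { clear Hl. induction l as [|t l [N IH]].
    - exists 0%nat. intros t [].
    - destruct (Hdelta (fst t, fst (snd t))) as [n Hn'].
      exists (Nat.max N n). intros t' [<-|Ht'] y Hy HK.
      + apply Hmon' with n; [lia|]. auto.
      + apply Hmon' with N; [lia|]. eauto. }
  destruct HN as [N HN]. exists N. intros [x y] HK.
  assert (Hb := HM _ HK).
  assert (Hr := Rmax_Cmod (x, y)). simpl in Hr.
  assert (Hx : Rabs x <= M) by (generalize (Rmax_l (Rabs x) (Rabs y)); lra).
  assert (Hy : Rabs y <= M) by (generalize (Rmax_r (Rabs x) (Rabs y)); lra).
  apply Rabs_le_between in Hx. apply Rabs_le_between in Hy.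
  destruct (Hl (x, (y, tt))) as [[u [v []]] (Hin & _ & Hc)]; [simpl; tauto|].
  apply (HN _ Hin); [|exact HK]. simpl in Hc |- *. split; simpl; apply Hc.
Qed.

Lemma within_continuous_eps (K : C -> Prop) (f : C -> R) (z : C) :
  filterlim f (within K (locally z)) (locally (f z)) ->
  forall eps, 0 < eps -> locally z (fun y : C => K y -> Rabs (f y - f z) < eps).
Proof.
  intros H eps He.
  apply (H (fun y => Rabs (y - f z) < eps)).
  exists (mkposreal eps He). intros y Hy. exact Hy.
Qed.

(** Two uses of [compactC_eventually]: with f <= n for boundedness, and, if the supremum M were not
    attained, with f <= M - 1/(n+1), which contradicts its minimality. *)
Lemma compactC_max (K : C -> Prop) (f : C -> R) :
  compactC K -> (exists z, K z) ->
  (forall z, K z -> filterlim f (within K (locally z)) (locally (f z))) ->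
  exists z0, K z0 /\ forall z, K z -> f z <= f z0.
Proof.
  intros HK [z1 Hz1] Hf.
  destruct (compactC_eventually K (fun n y => f y <= INR n) HK) as [n Hn].
  - intros n z H. rewrite S_INR. lra.
  - intros z Hz. destruct (nfloor_ex (Rmax 0 (f z + 1)) (Rmax_l _ _)) as [n Hn].
    exists (S n).
    generalize (within_continuous_eps K f z (Hf z Hz) 1 Rlt_0_1).
    apply filter_imp. intros y Hy HKy. specialize (Hy HKy).
    apply Rabs_lt_between in Hy. rewrite S_INR.
    generalize (Rmax_r 0 (f z + 1)); lra.
  - destruct (completeness (fun r => exists z, K z /\ r = f z)) as [M [HM1 HM2]].
    { exists (INR n). intros r (z & Hz & ->). auto. }
    { exists (f z1), z1. auto. }
    apply NNPP. intros Hno.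
    assert (Hlt : forall z, K z -> f z < M).
    { intros z Hz. destruct (Rle_lt_or_eq_dec (f z) M) as [H|H]; [apply HM1; eauto|exact H|].
      destruct Hno. exists z. split; [exact Hz|]. intros y Hy. rewrite H. apply HM1; eauto. }
    destruct (compactC_eventually K (fun n y => f y <= M - / (INR n + 1)) HK) as [m Hm].
    + intros m z H. rewrite S_INR.
      assert (/ (INR m + 1 + 1) <= / (INR m + 1)).
      { apply Rinv_le_contravar; generalize (pos_INR m); lra. }
      lra.
    + intros z Hz. assert (Hgap := Hlt z Hz).
      assert (He : 0 < (M - f z) / 2) by lra.
      destruct (archimed_cor1 _ He) as [m [Hm Hm0]].
      exists m. generalize (within_continuous_eps K f z (Hf z Hz) _ He).
      apply filter_imp. intros y Hy HKy. specialize (Hy HKy).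
      apply Rabs_lt_between in Hy.
      assert (/ (INR m + 1) <= / INR m).
      { apply Rinv_le_contravar; [apply lt_0_INR; exact Hm0|lra]. }
      lra.
    + assert (M <= M - / (INR m + 1)).
      { apply HM2. intros r (z & Hz & ->). auto. }
      assert (0 < / (INR m + 1)) by (apply Rinv_0_lt_compat; generalize (pos_INR m); lra).
      lra.
Qed.

(** * The maximum principle *)

(** The second derivative is used at the single point x. The mean value theorem for k(t) = f(x+t) +
    f(x-t) - L t^2 leaves k'(t) = f'(x+t) - f'(x-t) - 2 L t to be bounded by eta t, with eta/2 for
    each of the two points. *)
Lemma second_difference_le (f : R -> R) (x L : R) :
  locally x (fun t => ex_derive f t) -> is_derive (Derive f) x L ->
  forall eta, 0 < eta -> exists d, 0 < d /\
    forall s, 0 < s < d -> f (x + s) + f (x + - s) - 2 * f x <= (L + eta) * s ^ 2.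
Proof.
  intros [d1 Hd1] [_ HL] eta Heta.
  destruct (HL x (fun P H => H) (mkposreal (eta / 2) ltac:(lra))) as [d2 Hd2].
  exists (Rmin d1 d2). split; [apply Rmin_pos; apply cond_pos|].
  intros s [Hs0 Hs].
  assert (Hs1 : s < d1) by (eapply Rlt_le_trans; [exact Hs|apply Rmin_l]).
  assert (Hs2 : s < d2) by (eapply Rlt_le_trans; [exact Hs|apply Rmin_r]).
  pose (k := fun t => f (x + t) + f (x + - t) - L * t ^ 2).
  pose (dk := fun t => Derive f (x + t) - Derive f (x + - t) - 2 * L * t).
  assert (Hk : forall t, 0 <= t <= s -> is_derive k t (dk t)).
  { intros t Ht.
    assert (E1 : ex_derive f (x + t)).
    { apply Hd1. unfold ball; simpl; unfold AbsRing_ball, abs, minus, plus, opp; simpl.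
      replace (x + t + - x) with t by ring. rewrite Rabs_pos_eq; lra. }
    assert (E2 : ex_derive f (x + - t)).
    { apply Hd1. unfold ball; simpl; unfold AbsRing_ball, abs, minus, plus, opp; simpl.
      replace (x + - t + - x) with (- t) by ring. rewrite Rabs_Ropp, Rabs_pos_eq; lra. }
    unfold k, dk. auto_derive; [tauto|].
    change (fun x0 : R => f x0) with f. ring. }
  destruct (MVT_gen k 0 s dk) as (c & Hc & Heq).
  - intros t Ht. rewrite Rmin_left, Rmax_right in Ht by lra. apply Hk; lra.
  - intros t Ht. rewrite Rmin_left, Rmax_right in Ht by lra.
    apply derivable_continuous_pt. exists (dk t). apply is_derive_Reals. apply Hk; lra.
  - rewrite Rmin_left, Rmax_right in Hc by lra.
    assert (Hdk : dk c <= eta * c).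
    { generalize (Hd2 (x + c)), (Hd2 (x + - c)).
      unfold norm, ball, minus, plus, opp, scal; simpl;
      unfold AbsRing_ball, abs, minus, plus, opp, mult; simpl. unfold mult; simpl.
      replace (x + c + - x) with c by ring. replace (x + - c + - x) with (- c) by ring.
      rewrite Rabs_Ropp, Rabs_pos_eq by lra.
      intros I1 I2. assert (Hcd : c < d2) by lra. specialize (I1 Hcd). specialize (I2 Hcd).
      apply Rabs_le_between in I1. apply Rabs_le_between in I2.
      unfold dk. lra. }
    assert (Hdk' : dk c <= eta * s).
    { eapply Rle_trans; [exact Hdk|]. apply Rmult_le_compat_l; lra. }
    apply (Rmult_le_compat_r s) in Hdk'; [|lra].
    rewrite Rminus_0_r in Heq. rewrite <- Heq in Hdk'. unfold k in Hdk'.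
    rewrite Ropp_0, Rplus_0_r in Hdk'. lra.
Qed.

(** The defect is the sum of a horizontal and a vertical second difference, each with an error
    eta/2; their leading coefficients add up to the Laplacian, which is 0. *)
Lemma harmonic_four (h : C -> R) (z : C) : harmonic_at h z ->
  forall eta, 0 < eta -> exists d, 0 < d /\ forall s, 0 < s < d -> four h z s <= eta * s ^ 2.
Proof.
  intros Hh eta Heta.
  assert (Hz := locally_singleton _ _ Hh). cbv beta in Hz.
  destruct Hz as (_ & [Hxx _] & [_ Hyy] & _ & _ & _ & _ & _ & _ & _ & Hlap).
  destruct (second_difference_le (fun t => h (t, snd z)) (fst z) (dx (dx h) z)) with (eta := eta / 2)
    as (d1 & Hd1 & H1); [| |lra|].
  - destruct Hh as [d Hd]. exists d. intros t Ht.
    destruct (Hd (t, snd z)) as [[Hx _] _]; [split; [exact Ht|apply ball_center]|]. exact Hx.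
  - apply Derive_correct. exact Hxx.
  - destruct (second_difference_le (fun t => h (fst z, t)) (snd z) (dy (dy h) z)) with (eta := eta / 2)
      as (d2 & Hd2 & H2); [| |lra|].
    + destruct Hh as [d Hd]. exists d. intros t Ht.
      destruct (Hd (fst z, t)) as [[_ Hy] _]; [split; [apply ball_center|exact Ht]|]. exact Hy.
    + apply Derive_correct. exact Hyy.
    + exists (Rmin d1 d2). split; [apply Rmin_pos; assumption|].
      intros s [Hs0 Hs].
      assert (Hs1 : s < d1) by (eapply Rlt_le_trans; [exact Hs|apply Rmin_l]).
      assert (Hs2 : s < d2) by (eapply Rlt_le_trans; [exact Hs|apply Rmin_r]).
      specialize (H1 s (conj Hs0 Hs1)). specialize (H2 s (conj Hs0 Hs2)).
      unfold four. destruct z as [x y]. simpl fst in *; simpl snd in *.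
      replace ((x, y) + s)%C with (x + s, y)
        by (unfold Cplus; simpl; f_equal; ring).
      replace ((x, y) + - (1) * s)%C with (x + - s, y)
        by (unfold Cplus, Cmult, Copp; simpl; f_equal; ring).
      replace ((x, y) + Ci * s)%C with (x, y + s)
        by (unfold Cplus, Cmult, Ci; simpl; f_equal; ring).
      replace ((x, y) + - Ci * s)%C with (x, y + - s)
        by (unfold Cplus, Cmult, Ci, Copp; simpl; f_equal; ring).
      nra.
Qed.

Lemma four_Cmod2 (t : C) (s : R) : four (fun z => Cmod z ^ 2) t s = 4 * s ^ 2.
Proof.
  destruct t as [x y]. unfold four. rewrite !Cmod2_alt.
  unfold Cplus, Cmult, Ci, Copp, RtoC, Re, Im; simpl. ring.
Qed.

Lemma locally_four (t : C) (P : C -> Prop) : locally t P ->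
  exists d, 0 < d /\ forall s : R, 0 < s < d ->
    P (t + s)%C /\ P (t + - (1) * s)%C /\ P (t + Ci * s)%C /\ P (t + - Ci * s)%C.
Proof.
  intros [d Hd]. exists d. split; [apply cond_pos|].
  intros s Hs.
  assert (HH : forall c : C, Cmod c = 1 -> P (t + c * s)%C).
  { intros c Hc. apply Hd. apply C_NormedModule_mixin_compat1.
    replace (minus (t + c * s)%C t) with (c * s)%C.
    - rewrite Cmod_mult, Hc, Cmod_R, Rabs_pos_eq; lra.
    - change (c * s = t + c * s + - t)%C. ring. }
  repeat split; try apply HH.
  - replace (RtoC s) with (1 * s)%C by ring. apply HH, Cmod_1.
  - apply Cmod_m1.
  - apply Cmod_Ci.
  - rewrite Cmod_opp. apply Cmod_Ci.
Qed.

Lemma continuous_within (K : C -> Prop) (f : C -> R) (z : C) :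
  continuous f z -> filterlim f (within K (locally z)) (locally (f z)).
Proof.
  intros H. eapply filterlim_filter_le_1; [|exact H].
  intros P HP. unfold within. generalize HP. apply filter_imp. auto.
Qed.

(* Adding [eta |z|^2] makes the four-point defect of [g - h] positive, which excludes
   interior maxima. *)
Lemma maximum_principle (K : C -> Prop) (g h : C -> R) (eps : R) :
  compactC K -> (forall z, continuous g z) -> (forall z, sub4 g z) ->
  (forall z, K z -> filterlim h (within K (locally z)) (locally (h z))) ->
  (forall z, interiorC K z -> harmonic_at h z) ->
  (forall z, K z -> ~ interiorC K z -> g z <= h z + eps) ->
  forall z, K z -> g z <= h z + eps.
Proof.
  intros HK Hg Hsub Hh Hharm Hbd z Hz.
  destruct HK as [Hcl [M HM]].
  assert (HM0 : 0 <= M) by (generalize (HM z Hz), (Cmod_ge_0 z); lra).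
  assert (Hsq : forall y, K y -> 0 <= Cmod y ^ 2 <= M ^ 2).
  { intros y Hy. split; [apply pow2_ge_0|]. apply pow_incr. split; [apply Cmod_ge_0|auto]. }
  apply le_epsilon. intros e He.
  (* With this choice the perturbation eta |z|^2 stays below e on K. *)
  pose (eta := e / (M ^ 2 + 1)).
  assert (HM2 : 0 <= M ^ 2) by apply pow2_ge_0.
  assert (Heta : 0 < eta) by (apply Rdiv_lt_0_compat; lra).
  assert (HetaM : eta * (M ^ 2 + 1) = e) by (unfold eta; field; lra).
  pose (phi := fun y => g y - h y + eta * Cmod y ^ 2).
  destruct (compactC_max K phi) as (t & Ht & Hmax).
  - split; eauto.
  - eauto.
  - intros y Hy. unfold phi.
    assert (L1 := continuous_within K _ y (Hg y)). assert (L2 := Hh y Hy).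
    assert (L3 : filterlim (fun y => eta * Cmod y ^ 2) (within K (locally y)) (locally (eta * Cmod y ^ 2))).
    { apply continuous_within.
      apply (continuous_comp Cmod (fun r => eta * r ^ 2)).
      - apply (filterlim_norm (K := C_AbsRing) (V := C_NormedModule) y).
      - apply (ex_derive_continuous (K:=R_AbsRing) (V:=R_NormedModule)). auto_derive; trivial. }
    assert (L4 : filterlim (fun y => opp (h y)) (within K (locally y)) (locally (opp (h y))))
      by exact (filterlim_comp _ _ _ h opp _ _ _ L2 (filterlim_opp (V := R_NormedModule) _)).
    assert (L5 : filterlim (fun y => plus (g y) (opp (h y))) (within K (locally y))
              (locally (plus (g y) (opp (h y)))))
      by (eapply filterlim_comp_2; [exact L1|exact L4|apply (filterlim_plus (V := R_NormedModule))]).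
    eapply filterlim_comp_2; [exact L5|exact L3|apply (filterlim_plus (V := R_NormedModule))].
  - assert (Hphit : phi t <= eps + eta * M ^ 2).
    { destruct (classic (interiorC K t)) as [Hint|Hint].
      - exfalso.
        destruct (Hsub t) as (B & d1 & Hd1 & H1).
        destruct (harmonic_four h t (Hharm t Hint) eta Heta) as (d2 & Hd2 & H2).
        destruct (locally_four t K Hint) as (d3 & Hd3 & H3).
        (* [sub4] does not fix the sign of B; a positive majorant is needed to divide by when s is
           chosen. *)
        pose (B' := Rabs B + 1).
        assert (HB' : 0 < B') by (unfold B'; generalize (Rabs_pos B); lra).
        pose (s := Rmin (Rmin d1 d2) (Rmin d3 (eta / B')) / 2).
        assert (HeB : 0 < eta / B') by (apply Rdiv_lt_0_compat; assumption).
        assert (Hm : 0 < Rmin (Rmin d1 d2) (Rmin d3 (eta / B'))) by (repeat apply Rmin_pos; assumption).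
        assert (Hs : 0 < s) by (unfold s; lra).
        assert (Hs' : s < d1 /\ s < d2 /\ s < d3 /\ s < eta / B').
        { generalize (Rmin_l (Rmin d1 d2) (Rmin d3 (eta / B'))), (Rmin_r (Rmin d1 d2) (Rmin d3 (eta / B'))),
            (Rmin_l d1 d2), (Rmin_r d1 d2), (Rmin_l d3 (eta / B')), (Rmin_r d3 (eta / B')).
          unfold s. intros. repeat split; lra. }
        destruct Hs' as (Hs1 & Hs2 & Hs3 & Hs4).
        specialize (H1 s (conj Hs Hs1)). specialize (H2 s (conj Hs Hs2)).
        destruct (H3 s (conj Hs Hs3)) as (K1 & K2 & K3 & K4).
        assert (F : four phi t s <= 0).
        { unfold four. generalize (Hmax _ K1), (Hmax _ K2), (Hmax _ K3), (Hmax _ K4). lra. }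
        (* At an interior maximum the left side is at most 0. The right side is at least -B s^3 -
           eta s^2 + 4 eta s^2, which is positive because B s^3 <= eta s^2. *)
        assert (E : four phi t s = four g t s - four h t s + eta * four (fun z => Cmod z ^ 2) t s)
          by (unfold four, phi; ring).
        rewrite four_Cmod2 in E.
        assert (Hs5 : B' * s < eta).
        { apply Rmult_lt_reg_r with (/ B'); [apply Rinv_0_lt_compat; assumption|].
          replace (B' * s * / B') with s by (field; lra). exact Hs4. }
        assert (B * s ^ 3 <= eta * s ^ 2).
        { assert (B <= B') by (unfold B'; generalize (Rle_abs B); lra).
          assert (0 < s ^ 2) by (apply pow_lt; assumption).
          replace (B * s ^ 3) with ((B * s) * s ^ 2) by ring.
          apply Rmult_le_compat_r; nra. }
        assert (0 < eta * s ^ 2) by (apply Rmult_lt_0_compat; [|apply pow_lt]; assumption).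
        nra.
      - unfold phi. generalize (Hbd t Ht Hint), (Hsq t Ht). nra. }
    generalize (Hmax z Hz), (Hsq z Hz). unfold phi at 1. nra.
Qed.

(** A Dini argument: near each boundary point some g n is below h + e, where one e/3 pays for the
    limit at that point and one for the oscillation of each of g n and h. Monotonicity in n then
    gives one n for the whole boundary. *)
Lemma subharmonic_decreasing_limit (U : C -> Prop) (g : nat -> C -> R) (u : C -> R) :
  (forall n z, g (S n) z <= g n z) ->
  (forall z, is_lim_seq (fun n => g n z) (u z)) ->
  (forall n z, continuous (g n) z) ->
  (forall n z, sub4 (g n) z) ->
  subharmonic_on U (fun z => Finite (u z)).
Proof.
  intros Hdec Hlim Hcont Hsub.
  assert (Hle : forall n z, u z <= g n z).
  { intros n z. apply (is_lim_seq_decr_compare (fun n => g n z)); auto. }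
  assert (Hex : forall z m, u z < m -> exists n, g n z < m).
  { intros z m Hm. assert (H := Hlim z). apply is_lim_seq_spec in H.
    destruct (H (mkposreal (m - u z) ltac:(lra))) as [n Hn]. exists n.
    specialize (Hn n (le_n _)). simpl in Hn. apply Rabs_lt_between in Hn. lra. }
  split; [discriminate|split].
  - intros z _ m Hm. simpl in Hm. destruct (Hex z m Hm) as [n Hn].
    generalize (within_continuous_eps (fun _ => True) (g n) z (continuous_within _ _ _ (Hcont n z))
                  (m - g n z) ltac:(lra)).
    apply filter_imp. intros y Hy _. specialize (Hy I). apply Rabs_lt_between in Hy.
    simpl. generalize (Hle n y). lra.
  - intros K h HK _ Hh Hharm Hbd z Hz. simpl.
    apply le_epsilon. intros e He.
    (* The boundary of the closed set K; it is closed because the interior of K is open. *)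
    pose (D := fun z => K z /\ ~ interiorC K z).
    assert (HD : compactC D).
    { destruct HK as [Hcl [M HM]]. split.
      - intros y Hy. destruct (classic (K y)) as [H1|H1].
        + assert (Hint : interiorC K y) by (apply NNPP; intros H2; apply Hy; split; assumption).
          generalize (locally_locally _ _ Hint). apply filter_imp.
          intros x Hx [_ Hn]. apply Hn. exact Hx.
        + generalize (Hcl y H1). apply filter_imp. intros x Hx [H2 _]. auto.
      - exists M. intros y [Hy _]. auto. }
    destruct (compactC_eventually D (fun n y => g n y <= h y + e) HD) as [n Hn].
    + intros n y H. generalize (Hdec n y). lra.
    + intros y [Hy1 Hy2]. specialize (Hbd y Hy1 Hy2). simpl in Hbd.
      destruct (Hex y (h y + e / 3)) as [n Hn]; [lra|]. exists n.
      assert (L1 := within_continuous_eps K (g n) y (continuous_within _ _ _ (Hcont n y)) (e / 3) ltac:(lra)).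
      assert (L2 := within_continuous_eps K h y (Hh y Hy1) (e / 3) ltac:(lra)).
      generalize (filter_and _ _ L1 L2). apply filter_imp.
      intros x [X1 X2] [HKx _]. specialize (X1 HKx). specialize (X2 HKx).
      apply Rabs_lt_between in X1. apply Rabs_lt_between in X2. lra.
    + eapply Rle_trans; [apply (Hle n)|].
      apply (maximum_principle K (g n) h e); auto.
      intros y H1 H2. apply Hn. split; assumption.
Qed.

(** * Hénon maps, their inverses and their differentials *)

Definition hpoly (d : nat) (a : nat -> C) (z : C) : C :=
  (pow_n (K:=C_Ring) z d + sum_n (G:=C_AbelianMonoid)
        (fun k => (a k * pow_n (K:=C_Ring) z k)%C) (d - 1))%C.

(** The trailing factors 1 are the derivative of the identity and keep the chain-rule shape of
    [jet_pow]. *)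
Definition dhpoly (d : nat) (a : nat -> C) (z : C) : C :=
  (INR d * pow_n (K:=C_Ring) z (pred d) * 1 + sum_n (G:=C_AbelianMonoid)
        (fun k => (a k * (INR k * pow_n (K:=C_Ring) z (pred k) * 1))%C) (d - 1))%C.

Definition Dhenon (d : nat) (a : nat -> C) (delta : C) (p v : C2) : C2 :=
  ((dhpoly d a (fst p) * fst v + delta * snd v)%C, fst v).

Definition henon_inv (d : nat) (a : nat -> C) (delta : C) (q : C2) : C2 :=
  (snd q, (/ delta * (fst q + - hpoly d a (snd q)))%C).

Definition Dhenon_inv (d : nat) (a : nat -> C) (delta : C) (q v : C2) : C2 :=
  (snd v, (/ delta * (fst v + - (dhpoly d a (snd q) * snd v)))%C).

Fixpoint Dhenon_comp (d : nat) (a : nat -> nat -> C) (delta : nat -> C)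
    (n : nat) (p v : C2) : C2 :=
  match n with
  | O => v
  | S m => Dhenon d (a (S m)) (delta (S m)) (henon_comp d a delta m p)
             (Dhenon_comp d a delta m p v)
  end.

Fixpoint henon_inv_comp (d : nat) (a : nat -> nat -> C) (delta : nat -> C)
    (n : nat) (q : C2) : C2 :=
  match n with
  | O => q
  | S m => henon_inv_comp d a delta m (henon_inv d (a (S m)) (delta (S m)) q)
  end.

Fixpoint Dhenon_inv_comp (d : nat) (a : nat -> nat -> C) (delta : nat -> C)
    (n : nat) (q v : C2) : C2 :=
  match n with
  | O => v
  | S m => Dhenon_inv_comp d a delta m (henon_inv d (a (S m)) (delta (S m)) q)
             (Dhenon_inv d (a (S m)) (delta (S m)) q v)
  end.

Lemma henon_hpoly d a delta p :
  henon d a delta p = ((hpoly d a (fst p) + delta * snd p)%C, fst p).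
Proof. reflexivity. Qed.

(** Serves twice: for the differentiability of the maps, and for the four-point estimate on complex
    lines through [jet_henon_comp]. *)
Lemma jet_hpoly d a (f : C -> C) z c : jet f z c ->
  jet (fun x => hpoly d a (f x)) z (dhpoly d a (f z) * c)%C.
Proof.
  intros H. unfold hpoly.
  eapply jet_ext; [reflexivity| |apply jet_plus;
    [apply (jet_pow f z c d H)|
     apply (jet_sum (fun k x => (a k * pow_n (K:=C_Ring) (f x) k)%C) z
       (fun k => (a k * (INR k * pow_n (K:=C_Ring) (f z) (pred k) * c))%C))]].
  - unfold dhpoly.
    rewrite Cmult_plus_distr_r. f_equal; [ring|].
    etransitivity; [|exact (sum_n_mult_r (K:=C_Ring) c _ _)].
    apply sum_n_ext. intros k.
    change (a k * (INR k * pow_n (K:=C_Ring) (f z) (pred k) * c)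
      = a k * (INR k * pow_n (K:=C_Ring) (f z) (pred k) * 1) * c)%C. ring.
  - intros k _. apply jet_scal. apply jet_pow. exact H.
Qed.

Lemma filterdiff_jet (f : C -> C) (z c : C) : jet f z c ->
  filterdiff (K := C_AbsRing) (U := C_NormedModule) (V := C_NormedModule)
    f (locally z) (fun h => (c * h)%C).
Proof.
  intros (c2 & rho & [B HB] & Hf). split.
  - apply (is_linear_scal_r (K := C_AbsRing) (V := C_NormedModule) c). apply Cmult_comm.
  - intros x Hx.
    apply (is_filter_lim_locally_unique (K := C_AbsRing) (V := C_NormedModule)) in Hx. subst x.
    intros eps.
    (* The remainder is (c2 + rho s) s^2, and X bounds the first factor on the unit disc. *)
    pose (X := Cmod c2 + Rabs B + 1).
    assert (HX : 0 < X) by (unfold X; generalize (Cmod_ge_0 c2), (Rabs_pos B); lra).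
    assert (Hr : 0 < Rmin 1 (eps / X)).
    { apply Rmin_pos; [lra|]. apply Rdiv_lt_0_compat; [apply cond_pos|exact HX]. }
    apply (locally_le_locally_norm (K := C_AbsRing) (V := C_NormedModule)).
    exists (mkposreal _ Hr). intros y Hy.
    change (Cmod (y + - z) < Rmin 1 (eps / X)) in Hy.
    change (Cmod (f y + - f z + - (c * (y + - z))) <= eps * Cmod (y + - z)).
    set (s := (y + - z)%C) in *.
    replace y with (z + s)%C by (unfold s; ring). rewrite Hf.
    replace (f z + c * s + c2 * (s * s) + rho s * (s * s * s) + - f z + - (c * s))%C
      with ((c2 + rho s * s) * (s * s))%C by ring.
    assert (Hs1 : Cmod s < 1) by (eapply Rlt_le_trans; [exact Hy|apply Rmin_l]).
    assert (Hs2 : Cmod s < eps / X) by (eapply Rlt_le_trans; [exact Hy|apply Rmin_r]).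
    assert (Hs0 := Cmod_ge_0 s).
    assert (H1 : Cmod (c2 + rho s * s) <= X).
    { eapply Rle_trans; [apply Cmod_triangle|]. rewrite Cmod_mult.
      assert (Cmod (rho s) <= Rabs B) by (eapply Rle_trans; [apply HB; lra|apply Rle_abs]).
      assert (Cmod (rho s) * Cmod s <= Rabs B * 1).
      { apply Rmult_le_compat; auto using Cmod_ge_0; lra. }
      unfold X. lra. }
    assert (H2 : X * Cmod s <= eps).
    { apply Rmult_le_reg_r with (/ X); [apply Rinv_0_lt_compat; exact HX|].
      replace (X * Cmod s * / X) with (Cmod s) by (field; lra). unfold Rdiv in Hs2. lra. }
    rewrite !Cmod_mult. rewrite <- Rmult_assoc. apply Rmult_le_compat_r; [exact Hs0|].
    eapply Rle_trans; [|exact H2]. apply Rmult_le_compat_r; assumption.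
Qed.

Lemma filterdiff_hpoly d a z :
  filterdiff (K := C_AbsRing) (U := C_NormedModule) (V := C_NormedModule)
    (hpoly d a) (locally z) (fun h => (dhpoly d a z * h)%C).
Proof.
  apply filterdiff_jet.
  eapply jet_ext; [reflexivity| |apply (jet_hpoly d a (fun x => x) z 1%C), jet_id].
  ring.
Qed.

Lemma is_linear_mult (V : NormedModule C_AbsRing) (l : V -> C_NormedModule) (k : C) :
  is_linear l -> is_linear (V := C_NormedModule) (fun x => (k * l x)%C).
Proof.
  intros H. apply (is_linear_comp l (fun x : C_NormedModule => (k * x)%C)); [exact H|].
  apply (is_linear_scal_r (K := C_AbsRing) (V := C_NormedModule) k). apply Cmult_comm.
Qed.

(** The map is a sum of two parts: a one-variable polynomial composed with linear maps on both
    sides, and the linear map (z,w) -> (delta w, z). *)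
Lemma filterdiff_henon d a delta (p : C2) :
  filterdiff (K:=C_AbsRing) (U:=C2) (V:=C2) (henon d a delta) (locally p) (Dhenon d a delta p).
Proof.
  assert (H1 : filterdiff (K:=C_AbsRing) (U:=C2) (V:=C_NormedModule)
            (fun x : C2 => hpoly d a (fst x)) (locally p) (fun v => (dhpoly d a (fst p) * fst v)%C)).
  { apply (filterdiff_comp' (U:=C2) (V:=C_NormedModule) (W:=C_NormedModule) fst (hpoly d a) p fst
             (fun h => (dhpoly d a (fst p) * h)%C)).
    - apply filterdiff_linear. apply is_linear_fst.
    - apply filterdiff_hpoly. }
  assert (H2 : filterdiff (K:=C_AbsRing) (U:=C2) (V:=C2)
            (fun x : C2 => (hpoly d a (fst x), zero)) (locally p)
            (fun v => ((dhpoly d a (fst p) * fst v)%C, zero))).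
  { apply (filterdiff_comp' (U:=C2) (V:=C_NormedModule) (W:=C2) (fun x : C2 => hpoly d a (fst x))
      (fun y => (y, zero)) p (fun v : C2 => (dhpoly d a (fst p) * fst v)%C) (fun y => (y, zero)) H1).
    apply filterdiff_linear. apply is_linear_prod; [apply is_linear_id|apply is_linear_zero]. }
  assert (H3 : filterdiff (K:=C_AbsRing) (U:=C2) (V:=C2)
            (fun x : C2 => ((delta * snd x)%C, fst x)) (locally p)
            (fun v => ((delta * snd v)%C, fst v))).
  { apply filterdiff_linear.
    apply (is_linear_prod (T := C2) (U := C_NormedModule) (V := C_NormedModule) (fun x : C2 => (delta * snd x)%C) fst).
    - apply (is_linear_mult C2 snd). apply is_linear_snd.
    - apply is_linear_fst. }
  eapply filterdiff_ext_lin; [eapply filterdiff_ext; [|apply (filterdiff_plus_fct _ _ _ _ H2 H3)]|].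
  - intros x. rewrite henon_hpoly. cbn.
    apply (f_equal (pair _)). apply (plus_zero_l (G := C_AbelianGroup)).
  - intros v. cbn. apply (f_equal (pair _)). apply (plus_zero_l (G := C_AbelianGroup)).
Qed.

Lemma filterdiff_henon_inv d a delta (q : C2) :
  filterdiff (K:=C_AbsRing) (U:=C2) (V:=C2) (henon_inv d a delta) (locally q) (Dhenon_inv d a delta q).
Proof.
  assert (H1 : filterdiff (K:=C_AbsRing) (U:=C2) (V:=C_NormedModule)
            (fun x : C2 => hpoly d a (snd x)) (locally q) (fun v => (dhpoly d a (snd q) * snd v)%C)).
  { apply (filterdiff_comp' (U:=C2) (V:=C_NormedModule) (W:=C_NormedModule) snd (hpoly d a) q snd
             (fun h => (dhpoly d a (snd q) * h)%C)).
    - apply filterdiff_linear. apply is_linear_snd.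
    - apply filterdiff_hpoly. }
  assert (H2 : filterdiff (K:=C_AbsRing) (U:=C2) (V:=C2)
            (fun x : C2 => (zero, (- / delta * hpoly d a (snd x))%C)) (locally q)
            (fun v => (zero, (- / delta * (dhpoly d a (snd q) * snd v))%C))).
  { apply (filterdiff_comp' (U:=C2) (V:=C_NormedModule) (W:=C2) (fun x : C2 => hpoly d a (snd x))
      (fun y => (zero, (- / delta * y)%C)) q (fun v : C2 => (dhpoly d a (snd q) * snd v)%C)
      (fun y => (zero, (- / delta * y)%C)) H1).
    apply filterdiff_linear. apply is_linear_prod; [apply is_linear_zero|].
    apply (is_linear_mult C_NormedModule (fun y => y)). apply is_linear_id. }
  assert (H3 : filterdiff (K:=C_AbsRing) (U:=C2) (V:=C2)
            (fun x : C2 => (snd x, (/ delta * fst x)%C)) (locally q)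
            (fun v => (snd v, (/ delta * fst v)%C))).
  { apply filterdiff_linear.
    apply (is_linear_prod (T := C2) (U := C_NormedModule) (V := C_NormedModule) snd (fun x : C2 => (/ delta * fst x)%C)).
    - apply is_linear_snd.
    - apply (is_linear_mult C2 fst). apply is_linear_fst. }
  eapply filterdiff_ext_lin; [eapply filterdiff_ext; [|apply (filterdiff_plus_fct _ _ _ _ H2 H3)]|].
  - intros x. unfold henon_inv. apply injective_projections; cbn.
    + apply (plus_zero_l (G := C_AbelianGroup)).
    + change (- / delta * hpoly d a (snd x) + / delta * fst x = / delta * (fst x + - hpoly d a (snd x)))%C. ring.
  - intros v. unfold Dhenon_inv. apply injective_projections; cbn.
    + apply (plus_zero_l (G := C_AbelianGroup)).
    + change (- / delta * (dhpoly d a (snd q) * snd v) + / delta * fst v = / delta * (fst v + - (dhpoly d a (snd q) * snd v)))%C. ring.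
Qed.

Lemma filterdiff_henon_comp d a delta n (p : C2) :
  filterdiff (K:=C_AbsRing) (U:=C2) (V:=C2) (henon_comp d a delta n) (locally p) (Dhenon_comp d a delta n p).
Proof.
  induction n as [|n IH].
  - apply filterdiff_id.
  - apply (filterdiff_comp' (U:=C2) (V:=C2) (W:=C2) (henon_comp d a delta n) (henon d (a (S n)) (delta (S n))) p
      (Dhenon_comp d a delta n p) (Dhenon d (a (S n)) (delta (S n)) (henon_comp d a delta n p)) IH).
    apply filterdiff_henon.
Qed.

Lemma filterdiff_henon_inv_comp d a delta n (q : C2) :
  filterdiff (K:=C_AbsRing) (U:=C2) (V:=C2) (henon_inv_comp d a delta n) (locally q) (Dhenon_inv_comp d a delta n q).
Proof.
  revert q. induction n as [|n IH]; intros q.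
  - apply filterdiff_id.
  - apply (filterdiff_comp' (U:=C2) (V:=C2) (W:=C2) (henon_inv d (a (S n)) (delta (S n))) (henon_inv_comp d a delta n) q
      (Dhenon_inv d (a (S n)) (delta (S n)) q) _ (filterdiff_henon_inv _ _ _ _)).
    apply IH.
Qed.

Lemma henon_henon_inv d a delta q : delta <> RtoC 0 -> henon d a delta (henon_inv d a delta q) = q.
Proof.
  intros H. rewrite henon_hpoly. destruct q as [x y]. unfold henon_inv. simpl.
  apply injective_projections; simpl; [|reflexivity]. field. exact H.
Qed.

Lemma henon_inv_henon d a delta p : delta <> RtoC 0 -> henon_inv d a delta (henon d a delta p) = p.
Proof.
  intros H. rewrite henon_hpoly. destruct p as [x y]. unfold henon_inv. simpl.
  apply injective_projections; simpl; [reflexivity|]. field. exact H.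
Qed.

Lemma Dhenon_inv_Dhenon d a delta p v : delta <> RtoC 0 ->
  Dhenon_inv d a delta (henon d a delta p) (Dhenon d a delta p v) = v.
Proof.
  intros H. rewrite henon_hpoly. destruct p as [x y]. unfold Dhenon_inv, Dhenon. simpl.
  apply injective_projections; simpl; [reflexivity|]. field. exact H.
Qed.

Lemma henon_comp_inv d a delta n q : (forall k, (1 <= k)%nat -> delta k <> RtoC 0) ->
  henon_comp d a delta n (henon_inv_comp d a delta n q) = q.
Proof.
  intros H. revert q. induction n as [|n IH]; intros q; simpl; [reflexivity|].
  rewrite IH. apply henon_henon_inv. apply H. lia.
Qed.

Lemma henon_inv_comp_comp d a delta n p : (forall k, (1 <= k)%nat -> delta k <> RtoC 0) ->
  henon_inv_comp d a delta n (henon_comp d a delta n p) = p.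
Proof.
  intros H. induction n as [|n IH]; simpl; [reflexivity|].
  rewrite henon_inv_henon; [exact IH|]. apply H. lia.
Qed.

(** Used at the centre of the pulled-back disc, whose velocity has to be v / alpha. *)
Lemma Dhenon_inv_comp_comp d a delta n p v : (forall k, (1 <= k)%nat -> delta k <> RtoC 0) ->
  Dhenon_inv_comp d a delta n (henon_comp d a delta n p) (Dhenon_comp d a delta n p v) = v.
Proof.
  intros H. induction n as [|n IH]; simpl; [reflexivity|].
  rewrite henon_inv_henon, Dhenon_inv_Dhenon; [exact IH| |]; apply H; lia.
Qed.

(** * Growth *)

Lemma Cmod_pow_n (z : C) n : Cmod (pow_n (K:=C_Ring) z n) = Cmod z ^ n.
Proof.
  induction n as [|n IH]; [apply Cmod_1|].
  change (pow_n (K:=C_Ring) z (S n)) with (z * pow_n (K:=C_Ring) z n)%C.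
  rewrite Cmod_mult, IH. reflexivity.
Qed.

Lemma Cmod_sum_n (f : nat -> C) X n : (forall k, (k <= n)%nat -> Cmod (f k) <= X) ->
  Cmod (sum_n (G:=C_AbelianMonoid) f n) <= INR (S n) * X.
Proof.
  induction n as [|n IH]; intros H.
  - rewrite sum_O. simpl. generalize (H 0%nat (le_n _)). lra.
  - rewrite sum_Sn, S_INR. change (Cmod (sum_n (G:=C_AbelianMonoid) f n + f (S n))%C <= (INR (S n) + 1) * X).
    eapply Rle_trans; [apply Cmod_triangle|].
    generalize (IH (fun k Hk => H k (le_S _ _ Hk))), (H (S n) (le_n _)). lra.
Qed.

Lemma norm2_fst (p : C2) : Cmod (fst p) <= norm2 p.
Proof.
  unfold norm2. rewrite <- (sqrt_pow2 (Cmod (fst p))) at 1 by apply Cmod_ge_0.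
  apply sqrt_le_1_alt. generalize (pow2_ge_0 (Cmod (snd p))). lra.
Qed.

Lemma norm2_snd (p : C2) : Cmod (snd p) <= norm2 p.
Proof.
  unfold norm2. rewrite <- (sqrt_pow2 (Cmod (snd p))) at 1 by apply Cmod_ge_0.
  apply sqrt_le_1_alt. generalize (pow2_ge_0 (Cmod (fst p))). lra.
Qed.

Lemma norm2_le (p : C2) : norm2 p <= Cmod (fst p) + Cmod (snd p).
Proof.
  unfold norm2. generalize (Cmod_ge_0 (fst p)), (Cmod_ge_0 (snd p)). intros H1 H2.
  rewrite <- (sqrt_pow2 (Cmod (fst p) + Cmod (snd p))) by lra.
  apply sqrt_le_1_alt. nra.
Qed.

Lemma norm2_ge_0 (p : C2) : 0 <= norm2 p.
Proof. apply sqrt_pos. Qed.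

Definition bounded_coefs (d : nat) (M : R) (a : nat -> C) (delta : C) : Prop :=
  Cmod delta <= M /\ forall k, (k <= d - 1)%nat -> Cmod (a k) <= M.

Lemma lower_terms_le d M a delta z m : (1 <= d)%nat -> bounded_coefs d M a delta -> 1 <= m ->
  Cmod z <= m ->
  Cmod (sum_n (G:=C_AbelianMonoid) (fun k => (a k * pow_n (K:=C_Ring) z k)%C) (d - 1))
    <= INR d * (M * m ^ (d - 1)).
Proof.
  intros Hd [_ Ha] Hm Hz.
  replace d with (S (d - 1)) at 2 by lia. apply Cmod_sum_n.
  intros k Hk. rewrite Cmod_mult, Cmod_pow_n.
  apply Rmult_le_compat; auto using Cmod_ge_0.
  - apply pow_le, Cmod_ge_0.
  - apply Rle_trans with (m ^ k); [apply pow_incr; auto using Cmod_ge_0|]. apply Rle_pow; assumption.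
Qed.

(** The constant adds up 1 for the leading power, d M for the d lower terms, M for the term in w,
    and 1 for the second coordinate. *)
Lemma norm2_henon_le d M a delta (p : C2) : (1 <= d)%nat -> bounded_coefs d M a delta ->
  norm2 (henon d a delta p) <= (INR d * M + M + 2) * (Rmax 1 (norm2 p)) ^ d.
Proof.
  intros Hd Hc. assert (HM : 0 <= M) by (eapply Rle_trans; [apply Cmod_ge_0|exact (proj1 Hc)]).
  set (m := Rmax 1 (norm2 p)).
  assert (Hm : 1 <= m) by apply Rmax_l. assert (Hp : norm2 p <= m) by apply Rmax_r.
  assert (Hz := norm2_fst p). assert (Hw := norm2_snd p).
  eapply Rle_trans; [apply norm2_le|]. rewrite henon_hpoly. simpl fst; simpl snd. unfold hpoly.
  assert (T1 := Cmod_triangle (pow_n (K:=C_Ring) (fst p) d + sum_n (G:=C_AbelianMonoid)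
        (fun k => (a k * pow_n (K:=C_Ring) (fst p) k)%C) (d - 1)) (delta * snd p)).
  assert (T2 := Cmod_triangle (pow_n (K:=C_Ring) (fst p) d) (sum_n (G:=C_AbelianMonoid)
        (fun k => (a k * pow_n (K:=C_Ring) (fst p) k)%C) (d - 1))).
  assert (Hzm : Cmod (fst p) <= m) by lra.
  assert (T3 := lower_terms_le d M a delta (fst p) m Hd Hc Hm Hzm).
  rewrite Cmod_pow_n in T2. rewrite Cmod_mult in T1.
  assert (P1 : Cmod (fst p) ^ d <= m ^ d) by (apply pow_incr; split; [apply Cmod_ge_0|lra]).
  assert (P2 : m ^ (d - 1) <= m ^ d) by (apply Rle_pow; [exact Hm|lia]).
  assert (P3 : m <= m ^ d) by (rewrite <- (pow_1 m) at 1; apply Rle_pow; [exact Hm|lia]).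
  assert (P4 : INR d * (M * m ^ (d - 1)) <= INR d * (M * m ^ d)).
  { apply Rmult_le_compat_l; [apply pos_INR|]. apply Rmult_le_compat_l; assumption. }
  assert (P5 : Cmod delta * Cmod (snd p) <= M * m ^ d).
  { apply Rmult_le_compat; try apply Cmod_ge_0; [apply Hc|lra]. }
  replace ((INR d * M + M + 2) * m ^ d) with (m ^ d + INR d * (M * m ^ d) + M * m ^ d + m ^ d) by ring.
  apply Rplus_le_compat; [|exact (Rle_trans _ _ _ Hzm P3)].
  eapply Rle_trans; [exact T1|]. apply Rplus_le_compat; [|exact P5].
  eapply Rle_trans; [exact T2|]. apply Rplus_le_compat; [exact P1|].
  exact (Rle_trans _ _ _ T3 P4).
Qed.

(** The exponent d - 1, one less than for the map itself, is what keeps the differentials of the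
    compositions at the growth rate of the orbits. *)
Lemma norm2_Dhenon_le d M a delta (p v : C2) : (1 <= d)%nat -> bounded_coefs d M a delta ->
  norm2 (Dhenon d a delta p v) <=
    (INR d + INR d * (M * INR d) + M + 1) * (Rmax 1 (norm2 p)) ^ (d - 1) * norm2 v.
Proof.
  intros Hd Hc. assert (HM : 0 <= M) by (eapply Rle_trans; [apply Cmod_ge_0|exact (proj1 Hc)]).
  set (m := Rmax 1 (norm2 p)).
  assert (Hm : 1 <= m) by apply Rmax_l. assert (Hp : norm2 p <= m) by apply Rmax_r.
  assert (Hz := norm2_fst p).
  assert (Hv1 := norm2_fst v). assert (Hv2 := norm2_snd v).
  assert (P1 : 1 <= m ^ (d - 1)) by (apply pow_R1_Rle; exact Hm).
  set (X := m ^ (d - 1)) in *.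
  assert (PW : forall k, (k <= d - 1)%nat -> Cmod (fst p) ^ k <= X).
  { intros k Hk. apply Rle_trans with (m ^ k); [apply pow_incr; split; [apply Cmod_ge_0|lra]|].
    apply Rle_pow; assumption. }
  assert (HD : Cmod (dhpoly d a (fst p)) <= (INR d + INR d * (M * INR d)) * X).
  { unfold dhpoly. eapply Rle_trans; [apply Cmod_triangle|].
    rewrite Rmult_plus_distr_r. apply Rplus_le_compat.
    - rewrite !Cmod_mult, Cmod_1, Cmod_R, Cmod_pow_n, Rmult_1_r, Rabs_pos_eq by apply pos_INR.
      apply Rmult_le_compat_l; [apply pos_INR|]. apply PW. lia.
    - eapply Rle_trans; [apply (Cmod_sum_n _ (M * (INR d * X)))|
        replace (S (d - 1)) with d by lia; right; ring].
      intros k Hk. rewrite !Cmod_mult, Cmod_1, Cmod_R, Cmod_pow_n, Rmult_1_r, Rabs_pos_eq by apply pos_INR.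
      apply Rmult_le_compat; [apply Cmod_ge_0| |apply Hc; exact Hk|].
      + apply Rmult_le_pos; [apply pos_INR|apply pow_le, Cmod_ge_0].
      + apply Rmult_le_compat; [apply pos_INR|apply pow_le, Cmod_ge_0|apply le_INR; lia|apply PW; lia]. }
  eapply Rle_trans; [apply norm2_le|]. unfold Dhenon. simpl fst; simpl snd.
  assert (T := Cmod_triangle (dhpoly d a (fst p) * fst v) (delta * snd v)).
  rewrite !Cmod_mult in T.
  assert (N0 := norm2_ge_0 v).
  assert (Q1 : Cmod (dhpoly d a (fst p)) * Cmod (fst v) <= (INR d + INR d * (M * INR d)) * X * norm2 v).
  { apply Rmult_le_compat; try apply Cmod_ge_0; assumption. }
  assert (Q2 : Cmod delta * Cmod (snd v) <= M * norm2 v).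
  { apply Rmult_le_compat; try apply Cmod_ge_0; [apply Hc|assumption]. }
  assert (Q3 : M * norm2 v <= M * X * norm2 v).
  { apply Rmult_le_compat_r; [exact N0|]. rewrite <- (Rmult_1_r M) at 1. apply Rmult_le_compat_l; assumption. }
  assert (Q4 : norm2 v <= X * norm2 v).
  { rewrite <- (Rmult_1_l (norm2 v)) at 1. apply Rmult_le_compat_r; assumption. }
  replace ((INR d + INR d * (M * INR d) + M + 1) * X * norm2 v) with
    ((INR d + INR d * (M * INR d)) * X * norm2 v + M * X * norm2 v + X * norm2 v) by ring.
  apply Rplus_le_compat; [|exact (Rle_trans _ _ _ Hv1 Q4)].
  eapply Rle_trans; [exact T|]. apply Rplus_le_compat; [exact Q1|exact (Rle_trans _ _ _ Q2 Q3)].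
Qed.

(** The region |w| <= |z| is forward invariant for large |z|, as the new w is the old z. With x =
    |z|, all terms but z^d are together at most (d+1) M x^(d-1), which the threshold makes at most
    x^d / 2; and x >= 2 gives x^d / 2 >= x. *)
Lemma henon_escape d M a delta (p : C2) : (2 <= d)%nat -> bounded_coefs d M a delta ->
  Cmod (snd p) <= Cmod (fst p) -> 2 + 2 * (INR d + 1) * M <= Cmod (fst p) ->
  let q := henon d a delta p in
  Cmod (snd q) <= Cmod (fst q) /\ Cmod (fst p) <= Cmod (fst q) /\
  Cmod (fst p) ^ d / 2 <= Cmod (fst q).
Proof.
  intros Hd Hc Hw Hz.
  assert (HM : 0 <= M) by (eapply Rle_trans; [apply Cmod_ge_0|exact (proj1 Hc)]).
  assert (Hd0 := pos_INR d).
  set (x := Cmod (fst p)) in *.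
  assert (H0 : 0 <= (INR d + 1) * M) by (apply Rmult_le_pos; lra).
  assert (Hx : 2 <= x) by lra.
  assert (T3 := lower_terms_le d M a delta (fst p) x ltac:(lia) Hc ltac:(lra) (Rle_refl _)).
  rewrite henon_hpoly. unfold hpoly. cbv zeta. simpl fst; simpl snd.
  assert (HZ : Cmod (pow_n (K:=C_Ring) (fst p) d) = x ^ d) by apply Cmod_pow_n.
  cut (forall Z S : C, Cmod S <= INR d * (M * x ^ (d - 1)) -> Cmod Z = x ^ d ->
    Cmod (fst p) <= Cmod (Z + S + delta * snd p) /\ x <= Cmod (Z + S + delta * snd p) /\
    x ^ d / 2 <= Cmod (Z + S + delta * snd p)).
  { intros H. exact (H _ _ T3 HZ). }
  clear T3 HZ.
  intros Z S T3 HZ.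
  assert (T1 := Cmod_triangle (Z + S + delta * snd p) (- (S + delta * snd p))).
  replace (Z + S + delta * snd p + - (S + delta * snd p))%C with Z in T1 by ring.
  rewrite Cmod_opp, HZ in T1.
  assert (T2 := Cmod_triangle S (delta * snd p)). rewrite Cmod_mult in T2.
  assert (P1 : x <= x ^ (d - 1)) by (rewrite <- (pow_1 x) at 1; apply Rle_pow; [lra|lia]).
  assert (P2 : x ^ d = x * x ^ (d - 1)).
  { replace d with (Datatypes.S (d - 1)) at 1 by lia. reflexivity. }
  assert (P3 : Cmod delta * Cmod (snd p) <= M * x ^ (d - 1)).
  { apply Rmult_le_compat; try apply Cmod_ge_0; [apply Hc|lra]. }
  assert (P4 : 2 * (INR d + 1) * M * x ^ (d - 1) <= x * x ^ (d - 1)).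
  { apply Rmult_le_compat_r; lra. }
  assert (P5 : 2 * x <= x ^ d).
  { rewrite P2. apply Rmult_le_compat; lra. }
  assert (P6 : x ^ d / 2 <= Cmod (Z + S + delta * snd p)) by lra.
  repeat split; [fold x; lra|lra|exact P6].
Qed.

Lemma jet_henon_comp d a delta n (p q : C2) (t : C) :
  exists c1 c2, jet (fun x : C => fst (henon_comp d a delta n (plus p (scal x q)))) t c1 /\
    jet (fun x : C => snd (henon_comp d a delta n (plus p (scal x q)))) t c2.
Proof.
  induction n as [|n (c1 & c2 & H1 & H2)].
  - assert (H : forall u v : C, jet (fun x => (u + v * x)%C) t (0 + v * 1)%C).
    { intros u v. apply (jet_plus (fun _ => u)); [apply jet_const|apply jet_scal, jet_id]. }
    eexists; eexists; split.
    + eapply jet_ext; [|reflexivity|apply (H (fst p) (fst q))]. intros x.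
      change (fst p + fst q * x = fst p + x * fst q)%C. ring.
    + eapply jet_ext; [|reflexivity|apply (H (snd p) (snd q))]. intros x.
      change (snd p + snd q * x = snd p + x * snd q)%C. ring.
  - eexists; eexists; split.
    + apply (jet_plus (fun x => hpoly d (a (S n)) (fst (henon_comp d a delta n (plus p (scal x q)))))
        (fun x => (delta (S n) * snd (henon_comp d a delta n (plus p (scal x q))))%C)).
      * apply jet_hpoly. exact H1.
      * apply jet_scal. exact H2.
    + exact H1.
Qed.

(** * Preimages of balls *)

(** [norm2] is convertible with the norm of the product module [C2]. *)
Lemma norm2_triangle (p q : C2) : norm2 (plus p q) <= norm2 p + norm2 q.
Proof. exact (norm_triangle (V := C2) p q). Qed.

Lemma norm2_scal (k : C) (p : C2) : norm2 (scal k p) <= Cmod k * norm2 p.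
Proof. exact (norm_scal (V := C2) k p). Qed.

Lemma ex_filterdiff_comp (f g : C2 -> C2) (p : C2) :
  ex_filterdiff (K:=C_AbsRing) (U:=C2) (V:=C2) f (locally p) ->
  ex_filterdiff (K:=C_AbsRing) (U:=C2) (V:=C2) g (locally (f p)) ->
  ex_filterdiff (K:=C_AbsRing) (U:=C2) (V:=C2) (fun x => g (f x)) (locally p).
Proof.
  intros [lf Hf] [lg Hg]. eexists. exact (filterdiff_comp' f g p lf lg Hf Hg).
Qed.

Lemma ex_filterdiff_scal (k : C) (p : C2) :
  ex_filterdiff (K:=C_AbsRing) (U:=C2) (V:=C2) (fun x => scal k x) (locally p).
Proof.
  apply ex_filterdiff_linear. apply (is_linear_scal_r (K := C_AbsRing) (V := C2) k). exact Cmult_comm.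
Qed.

Lemma continuous_norm2 (f : C2 -> C2) (p : C2) : continuous f p -> continuous (fun x => norm2 (f x)) p.
Proof.
  intros H. apply (continuous_comp f norm2); [exact H|].
  exact (filterlim_norm (V := C2) (f p)).
Qed.

Lemma open_norm2_lt (f : C2 -> C2) (rho : R) : (forall p, continuous f p) ->
  open (fun p : C2 => norm2 (f p) < rho).
Proof.
  intros H p Hp. exact (continuous_norm2 f p (H p) _ (open_lt rho _ Hp)).
Qed.

(** Extends segments to paths continuous on the whole line, as the intermediate value theorem
    applied below requires. *)
Definition clamp (t : R) : R := Rmax 0 (Rmin 1 t).

Lemma clamp_bounds t : 0 <= clamp t <= 1.
Proof. unfold clamp, Rmax, Rmin. repeat destruct Rle_dec; lra. Qed.

Lemma clamp_lipschitz t s : Rabs (clamp t - clamp s) <= Rabs (t - s).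
Proof. unfold clamp, Rmax, Rmin, Rabs. repeat destruct Rle_dec; repeat destruct Rcase_abs; lra. Qed.

Definition segment (x y : C2) (t : R) : C2 := plus x (scal (RtoC (clamp t)) (minus y x)).

Lemma segment_0 x y : segment x y 0 = x.
Proof.
  unfold segment, clamp. rewrite Rmin_right, Rmax_left by lra.
  rewrite (scal_zero_l (K := C_AbsRing) (V := C2)). apply plus_zero_r.
Qed.

Lemma segment_1 x y : segment x y 1 = y.
Proof.
  unfold segment, clamp. rewrite Rmin_left, Rmax_right by lra.
  apply injective_projections.
  - change (fst x + 1 * (fst y + - fst x) = fst y)%C. ring.
  - change (snd x + 1 * (snd y + - snd x) = snd y)%C. ring.
Qed.

Lemma norm2_segment_lt x y t rho : norm2 x < rho -> norm2 y < rho -> norm2 (segment x y t) < rho.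
Proof.
  intros Hx Hy. destruct (clamp_bounds t) as [H0 H1]. unfold segment.
  set (c := clamp t) in *.
  assert (E : plus x (scal (RtoC c) (minus y x)) = plus (scal (RtoC (1 - c)) x) (scal (RtoC c) y)).
  { apply injective_projections.
    - change (fst x + c * (fst y + - fst x) = RtoC (1 - c) * fst x + c * fst y)%C.
      rewrite RtoC_minus. ring.
    - change (snd x + c * (snd y + - snd x) = RtoC (1 - c) * snd x + c * snd y)%C.
      rewrite RtoC_minus. ring. }
  rewrite E. eapply Rle_lt_trans; [apply norm2_triangle|].
  assert (N1 := norm2_scal (RtoC (1 - c)) x). assert (N2 := norm2_scal (RtoC c) y).
  rewrite Cmod_R, Rabs_pos_eq in N1 by lra. rewrite Cmod_R, Rabs_pos_eq in N2 by lra.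
  destruct (Req_dec c 0) as [Z|Z]; nra.
Qed.

Lemma continuous_segment x y t : continuous (segment x y) t.
Proof.
  intros P HP.
  apply (locally_norm_le_locally (V := C2)) in HP. destruct HP as [e He].
  set (L := norm2 (minus y x) + 1).
  assert (HL : 0 < L) by (unfold L; generalize (norm2_ge_0 (minus y x)); lra).
  assert (Hd : 0 < e / L) by (apply Rdiv_lt_0_compat; [apply cond_pos|exact HL]).
  exists (mkposreal _ Hd). intros s Hs. apply He.
  change (norm2 (minus (segment x y s) (segment x y t)) < e).
  change (Rabs (s - t) < e / L) in Hs.
  assert (E : minus (segment x y s) (segment x y t) = scal (RtoC (clamp s - clamp t)) (minus y x)).
  { unfold segment. rewrite RtoC_minus. apply injective_projections.
    - change (fst x + clamp s * (fst y + - fst x) + - (fst x + clamp t * (fst y + - fst x))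
        = (clamp s - clamp t) * (fst y + - fst x))%C. ring.
    - change (snd x + clamp s * (snd y + - snd x) + - (snd x + clamp t * (snd y + - snd x))
        = (clamp s - clamp t) * (snd y + - snd x))%C. ring. }
  rewrite E. eapply Rle_lt_trans; [apply norm2_scal|]. rewrite Cmod_R.
  apply Rle_lt_trans with (Rabs (s - t) * L).
  - apply Rmult_le_compat; [apply Rabs_pos|apply norm2_ge_0|apply clamp_lipschitz|unfold L; lra].
  - apply Rmult_lt_reg_r with (/ L); [apply Rinv_0_lt_compat; exact HL|].
    replace (Rabs (s - t) * L * / L) with (Rabs (s - t)) by (field; lra). exact Hs.
Qed.

(** Connectedness comes from paths: g maps a segment in the ball to a path in the preimage. If A and
    B separated its endpoints, the indicator of A along the path would be continuous and take the
    value 1/2. *)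
Lemma domain_preimage_ball (f g : C2 -> C2) (rho : R) : 0 < rho ->
  (forall p, continuous f p) -> (forall p, continuous g p) ->
  (forall p, f (g p) = p) -> (forall p, g (f p) = p) ->
  Defs.domain (fun p => norm2 (f p) < rho).
Proof.
  intros Hrho Cf Cg Hfg Hgf. split; [apply open_norm2_lt; exact Cf|split].
  - exists (g zero). rewrite Hfg. replace (norm2 zero) with 0; [exact Hrho|].
    symmetry. exact (norm_zero (V := C2)).
  - intros A B HA HB Hcov Hdisj (p & Hp & HpA) (q & Hq & HqB).
    pose (path := fun t => g (segment (f p) (f q) t)).
    assert (Hpath : forall t, norm2 (f (path t)) < rho).
    { intros t. unfold path. rewrite Hfg. apply norm2_segment_lt; assumption. }
    assert (Cpath : forall t, continuous path t).
    { intros t. apply (continuous_comp (segment (f p) (f q)) g); [apply continuous_segment|apply Cg]. }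
    pose (phi := fun t => if excluded_middle_informative (A (path t)) then 1 else 0).
    assert (Cphi : continuity phi).
    { intros t. apply continuity_pt_filterlim.
      destruct (Hcov _ (Hpath t)) as [H|H].
      - apply (continuous_ext_loc phi (fun _ => 1) t); [|apply continuous_const].
        assert (HL : locally t (fun s => A (path s))) by exact (Cpath t A (HA _ H)).
        revert HL. apply filter_imp. intros s Hs. unfold phi.
        destruct excluded_middle_informative; [reflexivity|contradiction].
      - apply (continuous_ext_loc phi (fun _ => 0) t); [|apply continuous_const].
        assert (HL : locally t (fun s => B (path s))) by exact (Cpath t B (HB _ H)).
        revert HL. apply filter_imp. intros s Hs. unfold phi.
        destruct excluded_middle_informative as [HAs|]; [|reflexivity].
        destruct (Hdisj _ (Hpath s) HAs Hs). }
    assert (P0 : path 0 = p) by (unfold path; rewrite segment_0; apply Hgf).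
    assert (P1 : path 1 = q) by (unfold path; rewrite segment_1; apply Hgf).
    assert (F0 : phi 0 = 1).
    { unfold phi. rewrite P0. destruct excluded_middle_informative; [reflexivity|contradiction]. }
    assert (F1 : phi 1 = 0).
    { unfold phi. rewrite P1. destruct excluded_middle_informative; [|reflexivity].
      destruct (Hdisj q); assumption. }
    destruct (IVT_gen phi 0 1 (1 / 2) Cphi) as (t & _ & Ht).
    { rewrite F0, F1, Rmin_right, Rmax_left; lra. }
    revert Ht. unfold phi. destruct excluded_middle_informative; lra.
Qed.

Lemma biholomorphic_preimage_ball (f g : C2 -> C2) (rho : R) : 0 < rho ->
  (forall p, ex_filterdiff (K:=C_AbsRing) (U:=C2) (V:=C2) f (locally p)) ->
  (forall p, ex_filterdiff (K:=C_AbsRing) (U:=C2) (V:=C2) g (locally p)) ->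
  (forall p, f (g p) = p) -> (forall p, g (f p) = p) ->
  biholomorphic (fun p => norm2 (f p) < rho) unit_ball.
Proof.
  intros Hrho Df Dg Hfg Hgf.
  assert (Hr : RtoC rho <> RtoC 0) by (intros E; apply RtoC_inj in E; lra).
  assert (S1 : forall q : C2, scal (RtoC rho) (scal (/ RtoC rho)%C q) = q).
  { intros q. rewrite scal_assoc. change (mult (RtoC rho) (/ RtoC rho)%C) with (rho * / rho)%C.
    rewrite Cinv_r by exact Hr. exact (scal_one (V := C2) q). }
  assert (S2 : forall q : C2, scal (/ RtoC rho)%C (scal (RtoC rho) q) = q).
  { intros q. rewrite scal_assoc. change (mult (/ RtoC rho)%C (RtoC rho)) with (/ rho * rho)%C.
    rewrite Cinv_l by exact Hr. exact (scal_one (V := C2) q). }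
  exists (fun p => scal (/ RtoC rho)%C (f p)), (fun q => g (scal (RtoC rho) q)).
  repeat split.
  - intros p _. apply (ex_filterdiff_comp f (fun x => scal (/ RtoC rho)%C x)); [apply Df|apply ex_filterdiff_scal].
  - intros p _. apply (ex_filterdiff_comp (fun x => scal (RtoC rho) x) g); [apply ex_filterdiff_scal|apply Dg].
  - intros p Hp. unfold unit_ball. eapply Rle_lt_trans; [apply norm2_scal|].
    rewrite Cmod_inv, Cmod_R, Rabs_pos_eq by (try exact Hr; lra).
    apply Rmult_lt_reg_l with rho; [exact Hrho|].
    rewrite <- Rmult_assoc, Rinv_r, Rmult_1_l, Rmult_1_r by lra. exact Hp.
  - intros q Hq. unfold unit_ball in Hq. rewrite Hfg. eapply Rle_lt_trans; [apply norm2_scal|].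
    rewrite Cmod_R, Rabs_pos_eq by lra. nra.
  - intros p _. rewrite S1. apply Hgf.
  - intros q _. rewrite Hfg. apply S2.
Qed.

Lemma kobayashi_royden_eq_0 (Omega : C2 -> Prop) (p v : C2) :
  (forall alpha, 0 < alpha -> exists f : C -> C2, holo_disc Omega f /\ f (RtoC 0) = p /\
      is_derive (K:=C_AbsRing) (V:=C2) f (RtoC 0) (scal (RtoC (/ alpha)) v)) ->
  kobayashi_royden Omega p v = Finite 0.
Proof.
  intros H. apply is_glb_Rbar_unique. split.
  - intros x [Hx _]. simpl. lra.
  - intros b Hb.
    assert (Hb' : forall x, 0 < x -> Rbar_le b x).
    { intros x Hx. apply Hb. split; auto. }
    destruct b as [b| |]; simpl in *.
    + apply Rnot_lt_le. intros Hlt. generalize (Hb' (b / 2)). lra.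
    + apply (Hb' 1). lra.
    + trivial.
Qed.

(** * The Green function *)

Definition admissible (d : nat) (M : R) (a : nat -> nat -> C) (delta : nat -> C) : Prop :=
  (2 <= d)%nat /\ (forall n, (1 <= n)%nat -> delta n <> RtoC 0) /\
  forall n, (1 <= n)%nat -> bounded_coefs d M (a n) (delta n).

(** The sum of the constants of [norm2_henon_le] and [norm2_Dhenon_le], so that it dominates
    both. *)
Definition growth (d : nat) (M : R) : R :=
  (INR d * M + M + 2) + (INR d + INR d * (M * INR d) + M + 1).

(* Adding [ln (growth d M)] makes the sequence decreasing, and it is large enough to absorb
   the constants in the growth of the differentials as well. *)
Definition green_approx d M a delta (n : nat) (p : C2) : R :=
  (logp (norm2 (henon_comp d a delta n p)) + ln (growth d M)) / INR d ^ n.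

Lemma admissible_M_ge_0 d M a delta : admissible d M a delta -> 0 <= M.
Proof.
  intros (_ & _ & H). eapply Rle_trans; [apply Cmod_ge_0|exact (proj1 (H 1%nat (le_n _)))].
Qed.

Lemma growth_parts d M : 0 <= M ->
  0 <= INR d * M + M /\ 0 <= INR d + INR d * (M * INR d) + M.
Proof.
  intros HM. assert (Hd := pos_INR d).
  assert (0 <= INR d * M) by (apply Rmult_le_pos; lra).
  assert (0 <= INR d * (M * INR d)) by (repeat apply Rmult_le_pos; lra).
  lra.
Qed.

Lemma growth_ge_1 d M : 0 <= M -> 1 <= growth d M.
Proof. intros HM. generalize (growth_parts d M HM). unfold growth. lra. Qed.

Lemma ln_growth_ge_0 d M : 0 <= M -> 0 <= ln (growth d M).
Proof. intros HM. rewrite <- ln_1. apply ln_le; [lra|]. apply growth_ge_1; exact HM. Qed.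

Lemma pow_INR_pos d n : (2 <= d)%nat -> 0 < INR d ^ n.
Proof. intros H. apply pow_lt. apply lt_0_INR. lia. Qed.

Lemma INR_ge_2 d : (2 <= d)%nat -> 2 <= INR d.
Proof. intros H. apply le_INR in H. exact H. Qed.

Lemma INR_le_pow d n : (2 <= d)%nat -> INR n <= INR d ^ n.
Proof.
  intros Hd. apply INR_ge_2 in Hd. induction n as [|n IH]; [simpl; lra|].
  rewrite S_INR. simpl pow.
  assert (1 <= INR d ^ n) by (apply pow_R1_Rle; lra).
  apply Rle_trans with (2 * INR d ^ n); [lra|]. apply Rmult_le_compat_r; lra.
Qed.

Lemma exp_logp x : exp (logp x) = Rmax 1 x.
Proof. rewrite logp_ln. apply exp_ln. generalize (Rmax_l 1 x); lra. Qed.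

Lemma logp_henon_le d M a delta n p : admissible d M a delta ->
  logp (norm2 (henon_comp d a delta (S n) p)) <=
    INR d * logp (norm2 (henon_comp d a delta n p)) + ln (growth d M).
Proof.
  intros Adm. assert (HM := admissible_M_ge_0 _ _ _ _ Adm). destruct Adm as (Hd & _ & Hc).
  assert (HA := growth_ge_1 d M HM).
  set (q := henon_comp d a delta n p).
  assert (H := norm2_henon_le d M (a (S n)) (delta (S n)) q ltac:(lia) (Hc (S n) ltac:(lia))).
  assert (Hm : 1 <= Rmax 1 (norm2 q)) by apply Rmax_l.
  assert (Hmd : 1 <= Rmax 1 (norm2 q) ^ d) by (apply pow_R1_Rle; exact Hm).
  rewrite !logp_ln. rewrite <- ln_pow by lra. rewrite Rplus_comm, <- ln_mult by lra.
  apply ln_le; [apply Rlt_le_trans with (1 := Rlt_0_1), Rmax_l|].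
  assert (H2 : (INR d * M + M + 2) * Rmax 1 (norm2 q) ^ d <= growth d M * Rmax 1 (norm2 q) ^ d).
  { apply Rmult_le_compat_r; [lra|]. generalize (growth_parts d M HM). unfold growth. lra. }
  apply Rmax_lub; [|exact (Rle_trans _ _ _ H H2)]. nra.
Qed.

(** With c = ln (growth d M) and the step estimate of [logp_henon_le], the claim reduces to 2 c <= d
    c, that is, to d >= 2 and c >= 0. *)
Lemma green_approx_decr d M a delta n p : admissible d M a delta ->
  green_approx d M a delta (S n) p <= green_approx d M a delta n p.
Proof.
  intros Adm. assert (HM := admissible_M_ge_0 _ _ _ _ Adm).
  assert (HL := logp_henon_le d M a delta n p Adm).
  assert (Hln := ln_growth_ge_0 d M HM). destruct Adm as (Hd & _).
  assert (HP := pow_INR_pos d n Hd). apply INR_ge_2 in Hd.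
  unfold green_approx.
  apply Rmult_le_reg_r with (INR d ^ S n); [simpl; apply Rmult_lt_0_compat; lra|].
  unfold Rdiv at 1. rewrite Rmult_assoc, Rinv_l by (apply pow_nonzero; lra).
  replace ((logp (norm2 (henon_comp d a delta n p)) + ln (growth d M)) / INR d ^ n * INR d ^ S n)
    with (INR d * (logp (norm2 (henon_comp d a delta n p)) + ln (growth d M))) by (simpl; field; lra).
  nra.
Qed.

Lemma green_approx_antitone d M a delta n m p : admissible d M a delta -> (n <= m)%nat ->
  green_approx d M a delta m p <= green_approx d M a delta n p.
Proof.
  intros Adm H. induction H as [|m _ IH]; [lra|].
  eapply Rle_trans; [apply green_approx_decr; exact Adm|exact IH].
Qed.

Lemma green_approx_ge_0 d M a delta n p : admissible d M a delta -> 0 <= green_approx d M a delta n p.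
Proof.
  intros Adm. assert (Hln := ln_growth_ge_0 d M (admissible_M_ge_0 _ _ _ _ Adm)).
  apply Rdiv_le_0_compat; [generalize (logp_ge_0 (norm2 (henon_comp d a delta n p))); lra|].
  apply pow_INR_pos. apply Adm.
Qed.

(** The correction ln (growth d M) / d^n tends to 0, so the [Lim_seq] in [green] is a genuine finite
    limit. *)
Lemma green_spec d M a delta p : admissible d M a delta -> exists G : R,
  green d a delta p = Finite G /\ is_lim_seq (fun n => green_approx d M a delta n p) G.
Proof.
  intros Adm.
  destruct (ex_finite_lim_seq_decr (fun n => green_approx d M a delta n p) 0) as [G HG].
  - intros n. apply green_approx_decr; exact Adm.
  - intros n. apply green_approx_ge_0; exact Adm.
  - exists G. split; [|exact HG].
    apply is_lim_seq_unique.
    assert (Hd : 2 <= INR d) by (apply INR_ge_2, Adm).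
    assert (H0 : is_lim_seq (fun n => ln (growth d M) * (/ INR d) ^ n) 0).
    { replace (Finite 0) with (Rbar_mult (ln (growth d M)) 0) by (simpl; f_equal; ring).
      apply is_lim_seq_scal_l. apply is_lim_seq_geom.
      rewrite Rabs_pos_eq by (left; apply Rinv_0_lt_compat; lra).
      rewrite <- Rinv_1. apply Rinv_lt_contravar; lra. }
    assert (H1 := is_lim_seq_minus' _ _ _ _ HG H0). rewrite Rminus_0_r in H1.
    eapply is_lim_seq_ext; [|exact H1].
    intros n. cbv beta. unfold green_approx. rewrite pow_inv. field. apply pow_nonzero. lra.
Qed.

Lemma green_lt_iff d M a delta p (r : R) : admissible d M a delta ->
  Rbar_lt (green d a delta p) r <-> exists n, green_approx d M a delta n p < r.
Proof.
  intros Adm. destruct (green_spec d M a delta p Adm) as (G & -> & HG). simpl. split.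
  - intros H. apply is_lim_seq_spec in HG.
    destruct (HG (mkposreal (r - G) ltac:(lra))) as [n Hn]. exists n.
    specialize (Hn n (le_n _)). simpl in Hn. apply Rabs_lt_between in Hn. lra.
  - intros [n Hn]. eapply Rle_lt_trans; [|exact Hn].
    apply (is_lim_seq_decr_compare (fun n => green_approx d M a delta n p)); [exact HG|].
    intros k. apply green_approx_decr. exact Adm.
Qed.

(** Positivity of the exponent means that the ball has radius greater than 1; for smaller radii log+
    could not detect the norm. *)
Lemma green_approx_lt_iff d M a delta n p r : (2 <= d)%nat -> 0 < r * INR d ^ n - ln (growth d M) ->
  green_approx d M a delta n p < r <->
  norm2 (henon_comp d a delta n p) < exp (r * INR d ^ n - ln (growth d M)).
Proof.
  intros Hd Hpos. assert (HP := pow_INR_pos d n Hd). unfold green_approx.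
  set (x := norm2 (henon_comp d a delta n p)). set (c := ln (growth d M)) in *.
  transitivity (logp x < r * INR d ^ n - c).
  - split; intros H.
    + apply (Rmult_lt_compat_r (INR d ^ n)) in H; [|exact HP].
      unfold Rdiv in H. rewrite Rmult_assoc, Rinv_l in H by lra. lra.
    + apply Rmult_lt_reg_r with (INR d ^ n); [exact HP|].
      unfold Rdiv. rewrite Rmult_assoc, Rinv_l by lra. lra.
  - split; intros H.
    + apply exp_increasing in H. rewrite exp_logp in H.
      eapply Rle_lt_trans; [apply Rmax_r|exact H].
    + apply exp_lt_inv. rewrite exp_logp. apply Rmax_lub_lt; [|exact H].
      rewrite <- exp_0. apply exp_increasing. exact Hpos.
Qed.

(** * Continuity of the approximations and plurisubharmonicity of the Green function *)

Lemma continuous_henon_comp d a delta n p : continuous (henon_comp d a delta n) p.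
Proof. apply (filterdiff_continuous (K:=C_AbsRing) (U:=C2) (V:=C2)). eexists. apply filterdiff_henon_comp. Qed.

Lemma continuous_logp x : continuous logp x.
Proof.
  apply (continuous_ext (fun x => ln (Rmax 1 x))); [intros; symmetry; apply logp_ln|].
  apply (continuous_comp (Rmax 1) ln).
  - intros P [e He]. exists e. intros y Hy. apply He.
    change (Rabs (y - x) < e) in Hy. change (Rabs (Rmax 1 y - Rmax 1 x) < e).
    eapply Rle_lt_trans; [|exact Hy].
    unfold Rmax, Rabs. repeat destruct Rle_dec; repeat destruct Rcase_abs; lra.
  - apply continuous_ln. generalize (Rmax_l 1 x); lra.
Qed.

Lemma continuous_green_approx d M a delta n p : continuous (green_approx d M a delta n) p.
Proof.
  unfold green_approx.
  apply (continuous_comp (fun p => logp (norm2 (henon_comp d a delta n p)))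
    (fun y => (y + ln (growth d M)) / INR d ^ n)).
  - apply (continuous_comp (fun p => norm2 (henon_comp d a delta n p)) logp);
      [|apply continuous_logp].
    apply continuous_norm2. apply continuous_henon_comp.
  - apply (ex_derive_continuous (K:=R_AbsRing) (V:=R_NormedModule)).
    unfold Rdiv. auto_derive. trivial.
Qed.

(** C carries two uniform structures, as a product of two real lines and as a ring with absolute
    value; [locally_C] passes from one to the other. *)
Lemma continuous_line (p q : C2) (t : C) :
  continuous (T := C_UniformSpace) (U := C2) (fun x : C => plus p (scal x q)) t.
Proof.
  intros P HP. apply locally_C. revert P HP.
  change (continuous (T := AbsRing_UniformSpace C_AbsRing) (U := C2) (fun x : C => plus p (scal x q)) t).
  apply (ex_derive_continuous (K := C_AbsRing) (V := C2)).
  eexists. apply (is_derive_plus (K := C_AbsRing) (V := C2)).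
  - apply is_derive_const.
  - apply (filterdiff_linear (K := C_AbsRing) (V := C2)), is_linear_scal_l.
Qed.

Lemma sub4_green_approx d M a delta n (p q : C2) (t : C) : (2 <= d)%nat ->
  sub4 (fun x => green_approx d M a delta n (plus p (scal x q))) t.
Proof.
  intros Hd. destruct (jet_henon_comp d a delta n p q t) as (c1 & c2 & H1 & H2).
  destruct (sub4_logp_norm2 _ t c1 c2 H1 H2) as (B & e & He & H).
  assert (HP : 0 < / INR d ^ n) by (apply Rinv_0_lt_compat, pow_INR_pos; exact Hd).
  exists (B * / INR d ^ n), e. split; [exact He|]. intros s Hs.
  specialize (H s Hs). unfold four in *. unfold green_approx, Rdiv.
  apply (Rmult_le_compat_r (/ INR d ^ n)) in H; [|lra]. lra.
Qed.

Lemma plurisubharmonic_green d M a delta (Omega : C2 -> Prop) : admissible d M a delta ->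
  plurisubharmonic_on Omega (green d a delta).
Proof.
  intros Adm.
  pose (u := fun p => real (green d a delta p)).
  assert (Hu : forall p, green d a delta p = Finite (u p)).
  { intros p. unfold u. destruct (green_spec d M a delta p Adm) as (G & -> & _). reflexivity. }
  split; [intros p _; rewrite Hu; discriminate|split].
  - intros p _ m Hm. apply (green_lt_iff d M) in Hm; [|exact Adm]. destruct Hm as [n Hn].
    assert (HL : locally p (fun y => green_approx d M a delta n y < m))
      by exact (continuous_green_approx d M a delta n p _ (open_lt m _ Hn)).
    revert HL. apply filter_imp. intros y Hy _. apply (green_lt_iff d M); [exact Adm|]. exists n. exact Hy.
  - intros p q.
    assert (H : subharmonic_on (fun t => Omega (plus p (scal t q))) (fun t => Finite (u (plus p (scal t q))))).
    { apply (subharmonic_decreasing_limit _ (fun n t => green_approx d M a delta n (plus p (scal t q)))).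
      - intros n z. apply green_approx_decr. exact Adm.
      - intros z. unfold u.
        destruct (green_spec d M a delta (plus p (scal z q)) Adm) as (G & -> & HG). exact HG.
      - intros n z. apply (continuous_comp (U := C_UniformSpace) (V := C2) (fun x : C => plus p (scal x q)) (green_approx d M a delta n)).
        + apply continuous_line.
        + apply continuous_green_approx.
      - intros n z. apply sub4_green_approx. apply Adm. }
    destruct H as (S1 & S2 & S3). split; [|split].
    + intros z Hz. rewrite Hu. apply S1. exact Hz.
    + intros z Hz m. rewrite Hu. intros Hm. generalize (S2 z Hz m Hm).
      apply filter_imp. intros y Hy. rewrite Hu. exact Hy.
    + intros K h HK HKU Hh Hharm Hbd z Hz. rewrite Hu.
      apply (S3 K h); try assumption. intros y Hy1 Hy2. rewrite <- Hu. auto.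
Qed.

(** * Growth of the differentials and vanishing of the Kobayashi-Royden metric *)

Lemma eventually_exp_pow_large d (e X : R) N : (2 <= d)%nat -> 0 < e ->
  exists n, (N <= n)%nat /\ X < exp (e * INR d ^ n).
Proof.
  intros Hd He.
  destruct (nfloor_ex (Rmax 0 (X / e)) (Rmax_l _ _)) as [k [_ Hk]].
  exists (N + S k)%nat. split; [lia|].
  apply Rlt_le_trans with (1 + e * INR d ^ (N + S k)); [|apply exp_ineq1_le].
  assert (H1 := INR_le_pow d (N + S k) Hd). rewrite plus_INR, S_INR in H1.
  assert (HN := pos_INR N). assert (HX := Rmax_r 0 (X / e)).
  assert (H2 : X / e < INR d ^ (N + S k)) by lra.
  apply (Rmult_lt_compat_l e) in H2; [|exact He].
  replace (e * (X / e)) with X in H2 by (field; lra). lra.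
Qed.

Lemma exp_le (x y : R) : x <= y -> exp x <= exp y.
Proof. intros [H| ->]; [left; apply exp_increasing; exact H|apply Rle_refl]. Qed.

Lemma exp_INR_mult n x : exp (INR n * x) = exp x ^ n.
Proof.
  induction n as [|n IH]; [simpl; rewrite Rmult_0_l; apply exp_0|].
  rewrite S_INR, Rmult_plus_distr_r, Rmult_1_l, exp_plus, IH. simpl. ring.
Qed.

(* The factor [growth d M] picked up at each step is compensated by the term
   [ln (growth d M)] in [green_approx]. *)
Lemma norm2_Dhenon_comp_le d M a delta p v r N n : admissible d M a delta -> (N <= n)%nat ->
  0 <= r -> green_approx d M a delta N p <= r ->
  norm2 (Dhenon_comp d a delta n p v) <= norm2 (Dhenon_comp d a delta N p v) * exp (r * INR d ^ n).
Proof.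
  intros Adm HNn Hr HN. assert (HM := admissible_M_ge_0 _ _ _ _ Adm).
  assert (Hc := proj2 (proj2 Adm)). assert (Hd := proj1 Adm).
  assert (Hln := ln_growth_ge_0 d M HM). assert (HA := growth_ge_1 d M HM).
  induction HNn as [|n HNn IH].
  - rewrite <- (Rmult_1_r (norm2 _)) at 1. apply Rmult_le_compat_l; [apply norm2_ge_0|].
    rewrite <- exp_0. apply exp_le. apply Rmult_le_pos; [exact Hr|].
    left. apply pow_INR_pos. exact Hd.
  - set (q := henon_comp d a delta n p). set (x := norm2 (Dhenon_comp d a delta n p v)) in *.
    set (y := norm2 (Dhenon_comp d a delta N p v)) in *.
    assert (H := norm2_Dhenon_le d M (a (S n)) (delta (S n)) q (Dhenon_comp d a delta n p v)
                   ltac:(lia) (Hc (S n) ltac:(lia))).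
    change (norm2 (Dhenon_comp d a delta (S n) p v) <=
      (INR d + INR d * (M * INR d) + M + 1) * Rmax 1 (norm2 q) ^ (d - 1) * x) in H.
    assert (HP := pow_INR_pos d n Hd).
    assert (HL : logp (norm2 q) <= r * INR d ^ n - ln (growth d M)).
    { assert (HG := green_approx_antitone d M a delta N n p Adm HNn).
      unfold green_approx at 1 in HG. fold q in HG.
      assert (HG' := Rle_trans _ _ _ HG HN).
      apply (Rmult_le_compat_r (INR d ^ n)) in HG'; [|lra].
      unfold Rdiv in HG'. rewrite Rmult_assoc, Rinv_l in HG' by lra. lra. }
    set (c := ln (growth d M)) in *.
    assert (HE : Rmax 1 (norm2 q) ^ (d - 1) <= exp (INR (d - 1) * (r * INR d ^ n - c))).
    { rewrite <- exp_logp. rewrite (exp_INR_mult (d - 1)).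
      apply pow_incr. split; [left; apply exp_pos|apply exp_le; exact HL]. }
    assert (Hx : 0 <= x) by apply norm2_ge_0.
    assert (Hy : 0 <= y) by apply norm2_ge_0.
    assert (Hd1 : INR (d - 1) = INR d - 1) by (rewrite minus_INR by lia; reflexivity).
    assert (Hd2 := INR_ge_2 d Hd).
    assert (HB : INR d + INR d * (M * INR d) + M + 1 <= exp c).
    { unfold c. rewrite exp_ln by lra. generalize (growth_parts d M HM). unfold growth. lra. }
    assert (HB0 : 0 <= INR d + INR d * (M * INR d) + M + 1) by (generalize (growth_parts d M HM); lra).
    assert (HE0 : 0 <= Rmax 1 (norm2 q) ^ (d - 1)).
    { apply pow_le. generalize (Rmax_l 1 (norm2 q)). lra. }
    eapply Rle_trans; [exact H|].
    apply Rle_trans with (exp c * exp (INR (d - 1) * (r * INR d ^ n - c)) * (y * exp (r * INR d ^ n))).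
    + apply Rmult_le_compat; try assumption; [apply Rmult_le_pos; assumption|].
      apply Rmult_le_compat; assumption.
    + replace (exp c * exp (INR (d - 1) * (r * INR d ^ n - c)) * (y * exp (r * INR d ^ n)))
        with (y * exp (c + INR (d - 1) * (r * INR d ^ n - c) + r * INR d ^ n))
        by (rewrite !exp_plus; ring).
      (* The exponent is c + (d-1)(r d^n - c) + r d^n = r d^(n+1) - (d-2) c, and d >= 2. *)
      apply Rmult_le_compat_l; [exact Hy|]. apply exp_le. rewrite Hd1. simpl. nra.
Qed.

Lemma kobayashi_royden_green d M a delta r p v : admissible d M a delta -> 0 < r ->
  Rbar_lt (green d a delta p) r ->
  kobayashi_royden (fun q => Rbar_lt (green d a delta q) r) p v = Finite 0.
Proof.
  intros Adm Hr Hp. apply kobayashi_royden_eq_0. intros alpha Halpha.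
  assert (Hd := proj1 Adm). assert (Hdelta := proj1 (proj2 Adm)).
  assert (Hln := ln_growth_ge_0 d M (admissible_M_ge_0 _ _ _ _ Adm)).
  assert (Hr' : exists r', 0 < r' < r /\ Rbar_lt (green d a delta p) r').
  { destruct (green_spec d M a delta p Adm) as (G & E & _). rewrite E in *. simpl in *.
    exists (Rmax (r / 2) ((G + r) / 2)). split.
    - split; [generalize (Rmax_l (r / 2) ((G + r) / 2)); lra|apply Rmax_lub_lt; lra].
    - generalize (Rmax_r (r / 2) ((G + r) / 2)); lra. }
  destruct Hr' as (r' & Hr' & Hp').
  apply (green_lt_iff d M) in Hp'; [|exact Adm]. destruct Hp' as [N HN].
  set (c := ln (growth d M)) in *.
  set (D := norm2 (Dhenon_comp d a delta N p v)).
  assert (HD : 0 <= D) by apply norm2_ge_0.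
  (* In units of exp(r' d^n), the centre q costs 1 and the vector w costs D / alpha; the second unit
     in the 2 makes the inequality strict. The factor exp c compensates the division by [growth d M]
     in the radius. *)
  destruct (eventually_exp_pow_large d (r - r') (exp c * (2 + D / alpha)) N Hd ltac:(lra)) as (n & HNn & Hn).
  assert (HP := pow_INR_pos d n Hd).
  set (q := henon_comp d a delta n p).
  set (w := scal (RtoC (/ alpha)) (Dhenon_comp d a delta n p v) : C2).
  assert (Hpos : 0 < r * INR d ^ n - c).
  { assert (H1 : 1 < exp ((r - r') * INR d ^ n - c)).
    { unfold Rminus at 1. rewrite exp_plus.
      apply (Rmult_lt_compat_r (exp (- c))) in Hn; [|apply exp_pos].
      rewrite (Rmult_comm (exp c)), Rmult_assoc, <- exp_plus, Rplus_opp_r, exp_0 in Hn.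
      assert (0 <= D / alpha) by (apply Rdiv_le_0_compat; assumption). lra. }
    rewrite <- exp_0 in H1. apply exp_lt_inv in H1.
    assert (0 <= r' * INR d ^ n) by (apply Rmult_le_pos; lra). lra. }
  assert (Hsmall : norm2 q + norm2 w < exp (r * INR d ^ n - c)).
  { assert (Hq : norm2 q <= exp (r' * INR d ^ n)).
    { assert (HG := green_approx_antitone d M a delta N n p Adm HNn).
      unfold green_approx at 1 in HG. fold q c in HG.
      assert (HG' : (logp (norm2 q) + c) / INR d ^ n <= r') by lra.
      apply (Rmult_le_compat_r (INR d ^ n)) in HG'; [|lra].
      unfold Rdiv in HG'. rewrite Rmult_assoc, Rinv_l in HG' by lra.
      apply Rle_trans with (Rmax 1 (norm2 q)); [apply Rmax_r|].
      rewrite <- exp_logp. apply exp_le. lra. }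
    assert (Hw : norm2 w <= D / alpha * exp (r' * INR d ^ n)).
    { eapply Rle_trans; [apply norm2_scal|].
      rewrite Cmod_R, Rabs_pos_eq by (left; apply Rinv_0_lt_compat; exact Halpha).
      unfold Rdiv. rewrite (Rmult_comm D), Rmult_assoc. apply Rmult_le_compat_l.
      - left. apply Rinv_0_lt_compat. exact Halpha.
      - apply norm2_Dhenon_comp_le with (M := M); [exact Adm|exact HNn|lra|lra]. }
    apply Rlt_le_trans with ((2 + D / alpha) * exp (r' * INR d ^ n)).
    - generalize (exp_pos (r' * INR d ^ n)). lra.
    - replace (r * INR d ^ n - c) with ((r - r') * INR d ^ n + (- c + r' * INR d ^ n)) by ring.
      rewrite !exp_plus. rewrite exp_Ropp.
      apply Rle_trans with (exp c * (2 + D / alpha) * (/ exp c * exp (r' * INR d ^ n))).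
      + right. field. split; [apply Rgt_not_eq, exp_pos|lra].
      + apply Rmult_le_compat_r; [|lra].
        apply Rmult_le_pos; [left; apply Rinv_0_lt_compat|left]; apply exp_pos. }
  pose (line := fun z : C => plus q (scal z w) : C2).
  assert (Dline : forall z : C, is_derive (K:=C_AbsRing) (V:=C2) line z w).
  { intros z. unfold line.
    apply (eq_ind (plus zero w) (is_derive (K := C_AbsRing) (V := C2) (fun x : C => plus q (scal x w)) z));
      [|apply plus_zero_l].
    apply (is_derive_plus (K := C_AbsRing) (V := C2)).
    - apply is_derive_const.
    - apply (filterdiff_linear (K := C_AbsRing) (V := C2)), is_linear_scal_l. }
  assert (Dcomp : forall z : C, filterdiff (K:=C_AbsRing) (U:=AbsRing_NormedModule C_AbsRing) (V:=C2)
      (fun x => henon_inv_comp d a delta n (line x)) (locally (T:=AbsRing_UniformSpace C_AbsRing) z)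
      (fun s => Dhenon_inv_comp d a delta n (line z) (scal s w))).
  { intros z. apply (filterdiff_comp' (K := C_AbsRing) (U := AbsRing_NormedModule C_AbsRing) (V := C2) (W := C2)
      line (henon_inv_comp d a delta n) z (fun s => scal s w) (Dhenon_inv_comp d a delta n (line z)) (Dline z)). apply filterdiff_henon_inv_comp. }
  assert (Dcomp' : forall z : C, is_derive (K:=C_AbsRing) (V:=C2)
      (fun x => henon_inv_comp d a delta n (line x)) z (Dhenon_inv_comp d a delta n (line z) w)).
  { intros z. eapply filterdiff_ext_lin; [apply Dcomp|]. intros s.
    apply (linear_scal _ (proj1 (filterdiff_henon_inv_comp d a delta n (line z)))). }
  assert (L0 : line (RtoC 0) = q).
  { unfold line. rewrite (scal_zero_l (K := C_AbsRing) (V := C2)). apply plus_zero_r. }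
  exists (fun z => henon_inv_comp d a delta n (line z)). split; [|split].
  - intros z Hz. split.
    + eexists. apply Dcomp'.
    + apply (green_lt_iff d M); [exact Adm|]. exists n.
      apply green_approx_lt_iff; [exact Hd|exact Hpos|].
      rewrite henon_comp_inv by exact Hdelta. unfold line.
      eapply Rle_lt_trans; [apply norm2_triangle|].
      eapply Rle_lt_trans; [|exact Hsmall]. apply Rplus_le_compat_l.
      eapply Rle_trans; [apply norm2_scal|].
      rewrite <- (Rmult_1_l (norm2 w)) at 2. apply Rmult_le_compat_r; [apply norm2_ge_0|lra].
  - rewrite L0. apply henon_inv_comp_comp. exact Hdelta.
  - replace (scal (RtoC (/ alpha)) v) with (Dhenon_inv_comp d a delta n (line (RtoC 0)) w); [apply Dcomp'|].
    rewrite L0. unfold w.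
    rewrite (linear_scal _ (proj1 (filterdiff_henon_inv_comp d a delta n q))).
    f_equal. apply Dhenon_inv_comp_comp. exact Hdelta.
Qed.

(** * Exhaustion of the sublevel set by preimages of balls *)

Lemma exhaustion_green d M a delta r : admissible d M a delta -> 0 < r ->
  exists Om : nat -> C2 -> Prop,
      (forall j, Defs.domain (Om j)) /\
      (forall j p, Om j p -> Om (S j) p) /\
      (forall p, Rbar_lt (green d a delta p) r <-> exists j, Om j p) /\
      (forall j, biholomorphic (Om j) unit_ball).
Proof.
  intros Adm Hr. assert (Hd := proj1 Adm). assert (Hdelta := proj1 (proj2 Adm)).
  set (c := ln (growth d M)).
  (* Starting at N makes every radius exceed 1, so that [green_approx_lt_iff] applies to all members
     of the exhaustion. *)
  destruct (eventually_exp_pow_large d r (exp c) 0 Hd Hr) as (N & _ & HN).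
  apply exp_lt_inv in HN.
  assert (Hpos : forall j, 0 < r * INR d ^ (N + j) - c).
  { intros j. assert (INR d ^ N <= INR d ^ (N + j)) by (apply Rle_pow; [generalize (INR_ge_2 d Hd); lra|lia]).
    apply (Rmult_le_compat_l r) in H; lra. }
  exists (fun j p => norm2 (henon_comp d a delta (N + j) p) < exp (r * INR d ^ (N + j) - c)).
  assert (Hiff : forall j p, green_approx d M a delta (N + j) p < r <->
     norm2 (henon_comp d a delta (N + j) p) < exp (r * INR d ^ (N + j) - c)).
  { intros j p. apply green_approx_lt_iff; [exact Hd|apply Hpos]. }
  assert (Df : forall n p, ex_filterdiff (K:=C_AbsRing) (U:=C2) (V:=C2) (henon_comp d a delta n) (locally p)).
  { intros n p. eexists. apply filterdiff_henon_comp. }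
  assert (Dg : forall n p, ex_filterdiff (K:=C_AbsRing) (U:=C2) (V:=C2) (henon_inv_comp d a delta n) (locally p)).
  { intros n p. eexists. apply filterdiff_henon_inv_comp. }
  split; [|split; [|split]].
  - intros j. apply (domain_preimage_ball (henon_comp d a delta (N + j)) (henon_inv_comp d a delta (N + j))).
    + apply exp_pos.
    + intros p. apply (filterdiff_continuous (K:=C_AbsRing) (U:=C2) (V:=C2)). apply Df.
    + intros p. apply (filterdiff_continuous (K:=C_AbsRing) (U:=C2) (V:=C2)). apply Dg.
    + intros p. apply henon_comp_inv. exact Hdelta.
    + intros p. apply henon_inv_comp_comp. exact Hdelta.
  - intros j p Hj. apply Hiff in Hj. apply Hiff. eapply Rle_lt_trans; [|exact Hj].
    apply green_approx_antitone; [exact Adm|lia].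
  - intros p. split.
    + intros H. apply (green_lt_iff d M) in H; [|exact Adm]. destruct H as [n Hn].
      exists n. apply Hiff. eapply Rle_lt_trans; [|exact Hn].
      apply green_approx_antitone; [exact Adm|lia].
    + intros [j Hj]. apply Hiff in Hj. apply (green_lt_iff d M); [exact Adm|]. eexists. exact Hj.
  - intros j. apply (biholomorphic_preimage_ball (henon_comp d a delta (N + j)) (henon_inv_comp d a delta (N + j))).
    + apply exp_pos.
    + apply Df.
    + apply Dg.
    + intros p. apply henon_comp_inv. exact Hdelta.
    + intros p. apply henon_inv_comp_comp. exact Hdelta.
Qed.

(** * Escaping orbits and non-constancy of the Green function *)

(** Each step multiplies ln |z| - ln 2 by at least d, because ln (x^d / 2) - ln 2 = d (ln x - ln 2)
    + (d-2) ln 2. *)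
Lemma henon_comp_escape d M a delta N p : admissible d M a delta ->
  Cmod (snd (henon_comp d a delta N p)) <= Cmod (fst (henon_comp d a delta N p)) ->
  2 + 2 * (INR d + 1) * M <= Cmod (fst (henon_comp d a delta N p)) ->
  forall k, let q := henon_comp d a delta (k + N) p in
  Cmod (snd q) <= Cmod (fst q) /\ 2 + 2 * (INR d + 1) * M <= Cmod (fst q) /\
  INR d ^ k * (ln (Cmod (fst (henon_comp d a delta N p))) - ln 2) <= ln (Cmod (fst q)) - ln 2.
Proof.
  intros Adm H1 H2. assert (HM := admissible_M_ge_0 _ _ _ _ Adm).
  destruct Adm as (Hd & _ & Hc). assert (Hd0 := INR_ge_2 d Hd).
  induction k as [|k (I1 & I2 & I3)].
  - simpl. split; [exact H1|split; [exact H2|lra]].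
  - cbv zeta in *. set (q := henon_comp d a delta (k + N) p) in *.
    change (henon_comp d a delta (S k + N) p) with (henon d (a (S (k + N))) (delta (S (k + N))) q).
    destruct (henon_escape d M (a (S (k + N))) (delta (S (k + N))) q Hd (Hc (S (k + N)) ltac:(lia)) I1 I2)
      as (J1 & J2 & J3).
    split; [exact J1|split; [exact (Rle_trans _ _ _ I2 J2)|]].
    assert (0 <= 2 * (INR d + 1) * M) by (apply Rmult_le_pos; lra).
    assert (Hq : 0 < Cmod (fst q)) by lra.
    assert (Hqd : 0 < Cmod (fst q) ^ d) by (apply pow_lt; exact Hq).
    apply ln_le in J3; [|lra].
    unfold Rdiv in J3. rewrite ln_mult, ln_pow, ln_Rinv in J3 by lra.
    assert (Hl2 : 0 < ln 2) by (rewrite <- ln_1; apply ln_increasing; lra).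
    set (A := ln (Cmod (fst (henon_comp d a delta N p))) - ln 2) in *.
    change (INR d ^ S k) with (INR d * INR d ^ k). rewrite Rmult_assoc.
    apply (Rmult_le_compat_l (INR d)) in I3; [|lra].
    assert (2 * ln 2 <= INR d * ln 2) by (apply Rmult_le_compat_r; lra).
    lra.
Qed.

Lemma green_nonconstant d M a delta r : admissible d M a delta -> 0 < r ->
  exists p q, Rbar_lt (green d a delta p) r /\ Rbar_lt (green d a delta q) r /\
    green d a delta p <> green d a delta q.
Proof.
  intros Adm Hr. assert (HM := admissible_M_ge_0 _ _ _ _ Adm).
  assert (Hd := proj1 Adm). assert (Hdelta := proj1 (proj2 Adm)). assert (Hd2 := INR_ge_2 d Hd).
  assert (Hc := ln_growth_ge_0 d M HM).
  pose (c := ln (growth d M)). fold c in Hc.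
  (* The first summand gives ln t - ln 2 > c, which separates the two values of G; the second puts
     (t,0) in the escape region. *)
  pose (t := 2 * exp (c + 1) + (2 + 2 * (INR d + 1) * M)).
  assert (H0 : 0 <= 2 * (INR d + 1) * M) by (apply Rmult_le_pos; lra).
  assert (He := exp_pos (c + 1)).
  assert (Ht : 2 < t) by (unfold t; lra).
  assert (Htl : c + 1 <= ln t - ln 2).
  { assert (ln (2 * exp (c + 1)) <= ln t) by (apply ln_le; [lra|unfold t; lra]).
    rewrite ln_mult, ln_exp in H by lra. lra. }
  (* As t does not depend on N, N can now be taken so large that (ln t + c) / d^N < r, which puts
     both points in the sublevel set. *)
  destruct (eventually_exp_pow_large d r (exp (ln t + c)) 0 Hd Hr) as (N & _ & HN).
  apply exp_lt_inv in HN.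
  assert (HP := pow_INR_pos d N Hd).
  pose (p1 := henon_inv_comp d a delta N zero).
  pose (p2 := henon_inv_comp d a delta N (RtoC t, RtoC 0)).
  assert (F1 : henon_comp d a delta N p1 = zero) by (apply henon_comp_inv; exact Hdelta).
  assert (F2 : henon_comp d a delta N p2 = (RtoC t, RtoC 0)) by (apply henon_comp_inv; exact Hdelta).
  assert (N1 : norm2 zero = 0) by exact (norm_zero (V := C2)).
  assert (N2 : norm2 (RtoC t, RtoC 0) <= t).
  { eapply Rle_trans; [apply norm2_le|]. simpl. rewrite Cmod_0, Cmod_R, Rabs_pos_eq; lra. }
  assert (A1 : green_approx d M a delta N p1 = c / INR d ^ N).
  { unfold green_approx. rewrite F1, N1, logp_ln, Rmax_left, ln_1 by lra. fold c. f_equal. ring. }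
  assert (A2 : green_approx d M a delta N p2 < r).
  { unfold green_approx. rewrite F2. fold c.
    apply Rmult_lt_reg_r with (INR d ^ N); [exact HP|].
    unfold Rdiv. rewrite Rmult_assoc, Rinv_l by lra.
    assert (L := logp_le _ _ N2). rewrite (logp_ln t), Rmax_right in L by lra. lra. }
  assert (Hl2 : 0 < ln 2) by (rewrite <- ln_1; apply ln_increasing; lra).
  assert (A1r : green_approx d M a delta N p1 < r).
  { rewrite A1. apply Rmult_lt_reg_r with (INR d ^ N); [exact HP|].
    unfold Rdiv. rewrite Rmult_assoc, Rinv_l by lra. lra. }
  exists p1, p2. split; [|split].
  - apply (green_lt_iff d M); [exact Adm|]. exists N. exact A1r.
  - apply (green_lt_iff d M); [exact Adm|]. exists N. exact A2.
  - apply Rbar_lt_not_eq.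
    apply Rbar_lt_le_trans with (Finite ((ln t - ln 2) / INR d ^ N)).
    (* The N-th approximation at p1 is c / d^N, already below the separating value, and G is at most
       that approximation. *)
    + apply (green_lt_iff d M); [exact Adm|]. exists N. rewrite A1.
      apply Rmult_lt_compat_r; [apply Rinv_0_lt_compat; exact HP|lra].
    + destruct (green_spec d M a delta p2 Adm) as (G & -> & HG). simpl.
      (* The lower bound is available only from the index N on, where the orbit of p2 sits at
         (t,0). *)
      apply (is_lim_seq_incr_n _ N) in HG.
      refine (is_lim_seq_le (fun _ => (ln t - ln 2) / INR d ^ N) _ _ G _ (is_lim_seq_const _) HG).
      intros k.
      destruct (henon_comp_escape d M a delta N p2 Adm) with (k := k) as (J1 & J2 & J3).
      { rewrite F2. simpl. rewrite Cmod_0. apply Cmod_ge_0. }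
      { rewrite F2. simpl. rewrite Cmod_R, Rabs_pos_eq by lra. unfold t. lra. }
      cbv zeta in J1, J2, J3. rewrite F2 in J3. simpl fst in J3.
      rewrite Cmod_R, Rabs_pos_eq in J3 by lra.
      set (q := henon_comp d a delta (k + N) p2) in *.
      assert (J4 : ln (Cmod (fst q)) <= logp (norm2 q)).
      { eapply Rle_trans; [|apply ln_le_logp]. apply ln_le; [lra|apply norm2_fst]. }
      unfold green_approx. fold q c.
      apply Rmult_le_reg_r with (INR d ^ (k + N)); [apply pow_INR_pos; exact Hd|].
      assert (HPk := pow_INR_pos d k Hd).
      replace ((logp (norm2 q) + c) / INR d ^ (k + N) * INR d ^ (k + N)) with (logp (norm2 q) + c)
        by (field; apply pow_nonzero; lra).
      replace ((ln t - ln 2) / INR d ^ N * INR d ^ (k + N)) with (INR d ^ k * (ln t - ln 2))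
        by (rewrite pow_add; field; apply pow_nonzero; lra).
      assert (J5 : ln (Cmod (fst q)) - ln 2 <= logp (norm2 q) + c) by lra.
      exact (Rle_trans _ _ _ J3 J5).
Qed.

Theorem theorem1p6 (d : nat) (a : nat -> nat -> C) (delta : nat -> C) :
  (2 <= d)%nat ->
  (forall n, (1 <= n)%nat -> delta n <> RtoC 0) ->
  (exists M : R, forall n, (1 <= n)%nat ->
      Cmod (delta n) <= M /\ (forall k, (k <= d - 1)%nat -> Cmod (a n k) <= M)) ->
  forall r : R, 0 < r ->
    short_C2 (fun p => Rbar_lt (green d a delta p) r).
Proof.
  intros Hd Hdelta [M HM] r Hr.
  assert (Adm : admissible d M a delta) by (repeat split; auto; apply HM; assumption).
  split; [|split].
  - exact (exhaustion_green d M a delta r Adm Hr).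
  - intros p v Hp. exact (kobayashi_royden_green d M a delta r p v Adm Hr Hp).
  - exists (green d a delta). split; [exact (plurisubharmonic_green d M a delta _ Adm)|split].
    + exists r. intros p Hp. apply Rbar_lt_le. exact Hp.
    + exact (green_nonconstant d M a delta r Adm Hr).
Qed.
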